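(* Let $d\ge2$, let $k\ge\max\{d,3\}$ be an integer, let $K\subset\mathbb R^d$ be a nondegenerate $d$-simplex, and take the shape function space $V(\operatorname{div}\operatorname{div};\mathbb S):=\mathbb P_k(K;\mathbb S)$. Then the degrees of freedom $$\boldsymbol\tau(\delta)\quad\forall\,\delta\in\mathcal V(K),$$ $$(\boldsymbol n_i^{\intercal}\boldsymbol\tau\boldsymbol n_j,q)_F\quad\forall\,q\in\mathbb P_{k+r-d-1}(F),\ F\in\mathcal F^r(K),\ i,j=1,\dots,r,\ r=1,\dots,d-1,$$ $$(\Pi_F\boldsymbol\tau\boldsymbol n,\boldsymbol q)_F\quad\forall\,\boldsymbol q\in \mathrm{ND}_{k-2}(F),\ F\in\mathcal F^1(K),$$ $$(\boldsymbol n^{\intercal}\operatorname{div}\boldsymbol\tau+\operatorname{div}_F(\boldsymbol\tau\boldsymbol n),p)_F\quad\forall\,p\in\mathbb P_{k-1}(F),\ F\in\mathcal F^1(K),$$ $$(\boldsymbol\tau,\operatorname{def}\boldsymbol q)_K\quad\forall\,\boldsymbol q\in\mathrm{ND}_{k-3}(K),$$ $$(\boldsymbol\tau,\boldsymbol q)_K\quad\forall\,\boldsymbol q\in\ker(\cdot\boldsymbol x)\cap\mathbb P_{k-2}(K;\mathbb S)$$ are uni-solvent for $\mathbb P_k(K;\mathbb S)$.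
   Context: Coordinates $\boldsymbol x$ on $\mathbb R^d$ are chosen with the origin in $K$. $\mathcal F^r(K)$ is the set of $(d-r)$-dimensional faces of $K$, and $\mathcal V(K)=\mathcal F^d(K)$ is the set of vertices. For $F\in\mathcal F^r(K)$ with $1\le r\le d-1$, $\boldsymbol n_1,\dots,\boldsymbol n_r$ (depending on $F$) are mutually orthogonal unit vectors spanning the orthogonal complement of the tangent space of $F$; for $r=1$ write $\boldsymbol n=\boldsymbol n_1$, $\Pi_F\boldsymbol v=(\boldsymbol I-\boldsymbol n\boldsymbol n^{\intercal})\boldsymbol v$, and $\operatorname{div}_F\boldsymbol v=\sum_{i=1}^{d-1}\boldsymbol t_i\cdot\partial_{\boldsymbol t_i}\boldsymbol v$ for an orthonormal basis $\boldsymbol t_1,\dots,\boldsymbol t_{d-1}$ of the tangent space of $F$ (surface divergence). $(\cdot,\cdot)_F$, $(\cdot,\cdot)_K$ are $L^2$ inner products. $\mathbb S$ (resp. $\mathbb K$) is the space of symmetric (resp. skew-symmetric) real matrices of the appropriate size ($d\times d$ on $K$). $\mathbb P_m(D)$ is the space of polynomials on $D$ of total degree $\le m$ ($\{0\}$ if $m<0$), $\mathbb H_m(D)$ is the space of homogeneous polynomials of degree $m$, and $\mathbb P_m(D;X)$, $\mathbb H_m(D;X)$ are the $X$-valued versions. For a simplex $D$ of dimension $s$ (a face being identified with a simplex in $\mathbb R^{s}$ through Cartesian coordinates $\boldsymbol x$ of its affine hull, tangential vectors being identified with $\mathbb R^s$), $\mathrm{ND}_m(D)=\mathbb P_m(D;\mathbb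 R^s)\oplus\mathbb H_m(D;\mathbb K)\boldsymbol x$ ($\{\boldsymbol 0\}$ if $m<0$). $\operatorname{div}$ of a matrix field is taken row-wise; $\operatorname{def}\boldsymbol q=\operatorname{sym}\nabla\boldsymbol q$ is the symmetric gradient. $\ker(\cdot\boldsymbol x)$ denotes matrix fields $\boldsymbol\tau$ with $\boldsymbol\tau\boldsymbol x=\boldsymbol 0$. Uni-solvent for a finite-dimensional space $V$ means: (a) the only $\boldsymbol\tau\in V$ for which all listed quantities vanish is $\boldsymbol\tau=\boldsymbol 0$; and (b) the number of degrees of freedom equals $\dim V$, where one counts $d(d+1)/2$ for each vertex value $\boldsymbol\tau(\delta)$, only pairs $i\le j$ in the families with $\boldsymbol n_i^{\intercal}\boldsymbol\tau\boldsymbol n_j$ (by symmetry), $\dim\{\operatorname{def}\boldsymbol q\}$ for the family tested against $\operatorname{def}\boldsymbol q$, and for every other family tested against $q$ in a space $Q$ the number $\dim Q$. (In a global finite element space, the degrees of freedom $(\Pi_F\boldsymbol\tau\boldsymbol n,\boldsymbol q)_F$ are treated as interior to $K$, i.e. not single-valued across elements; this does not affect uni-solvence.) *)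

(* Defs.v *)
(* MathComp with MathComp-Analysis and multinomials.  mpoly must be imported before the analysis files, because
   of a clash between their notations. *)
From HB Require Import structures.
From mathcomp Require Import all_boot all_order all_algebra.
From mathcomp.multinomials Require Import mpoly.
From mathcomp Require Import classical_sets reals measure lebesgue_measure.
From mathcomp Require Import lebesgue_Rintegral.

Set Implicit Arguments.
Unset Strict Implicit.
Unset Printing Implicit Defensive.

Import Order.TTheory GRing.Theory Num.Theory.
Local Open Scope ring_scope.

(* Points of R^d are row vectors, as are the members of orthonormal frames (the
   rows of a frame matrix).  Vector fields are column vectors of polynomials, so
   that tau *m v, tau *m coords and n *m tau *m n^T are the usual products. *)

Section Dimension.
Variables (R : realType) (s : nat) (V : lmodType {mpoly R[s]}).
Implicit Type S : V -> Prop.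

(* S is a real vector space with a basis of n elements; scalars act on V
   through constant polynomials. *)
Definition has_dim S (n : nat) : Prop :=
  exists b : 'I_n -> V,
    (forall c : 'I_n -> R,
       \sum_(i < n) (c i)%:MP *: b i = 0 -> forall i, c i = 0) /\
    (forall v, S v <-> exists c : 'I_n -> R, v = \sum_(i < n) (c i)%:MP *: b i).

(* Only meaningful when S is finite-dimensional (0 otherwise). *)
Definition polydim S : nat := xget 0%N (has_dim S).

Definition unisolvent S (vanish : V -> Prop) (ndof : nat) : Prop :=
  (forall v, S v -> vanish v -> v = 0) /\ has_dim S ndof.

End Dimension.

Section Polynomials.
Variables (R : realType) (s : nat).
Local Notation P := {mpoly R[s]}.

Definition ev (p : P) (x : 'rV[R]_s) : R := p.@[fun i => x 0 i].

Definition evM m n (M : 'M[P]_(m, n)) (x : 'rV[R]_s) : 'M[R]_(m, n) :=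
  map_mx (fun p => ev p x) M.

Definition cstM m n (M : 'M[R]_(m, n)) : 'M[P]_(m, n) :=
  map_mx (fun c => c%:MP) M.

Definition coords : 'cV[P]_s := \col_i 'X_i.

(* msize is the degree plus one, and 0 for the zero polynomial *)
Definition Pol (m : nat) (p : P^o) : Prop := (msize (p : P) <= m.+1)%N.

Definition PolM m n (deg : nat) (M : 'M[P]_(m, n)) : Prop :=
  forall i j, Pol deg (M i j).

Definition HomM m n (deg : nat) (M : 'M[P]_(m, n)) : Prop :=
  forall i j, M i j \is deg.-homog.

Definition PolSym (deg : nat) (tau : 'M[P]_s) : Prop :=
  PolM deg tau /\ tau^T = tau.

Definition ND (deg : nat) (q : 'cV[P]_s) : Prop :=
  exists (p : 'cV[P]_s) (B : 'M[P]_s),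
    [/\ PolM deg p, HomM deg B, B^T = - B & q = p + B *m coords].

Definition ker_x_PolSym (deg : nat) (tau : 'M[P]_s) : Prop :=
  PolSym deg tau /\ tau *m coords = 0.

Definition grad (q : 'cV[P]_s) : 'M[P]_s := \matrix_(i, j) mderiv j (q i 0).

Definition sym_grad (q : 'cV[P]_s) : 'M[P]_s :=
  (2^-1 : R)%:MP *: (grad q + (grad q)^T).

Definition defND (deg : nat) (sigma : 'M[P]_s) : Prop :=
  exists2 q, ND deg q & sigma = sym_grad q.

Definition row_div (tau : 'M[P]_s) : 'cV[P]_s :=
  \col_i \sum_j mderiv j (tau i j).

Definition dder (t : 'rV[R]_s) (v : 'cV[P]_s) : 'cV[P]_s :=
  \sum_j (t 0 j)%:MP *: map_mx (mderiv j) v.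

Definition divF r (T : 'M[R]_(r, s)) (v : 'cV[P]_s) : P :=
  \sum_i (cstM (row i T) *m dder (row i T) v) 0 0.

Definition PiF (n : 'rV[R]_s) (v : 'cV[P]_s) : 'cV[P]_s :=
  (1%:M - cstM (n^T *m n)) *m v.

End Polynomials.

Section Simplices.
Variable R : realType.

Definition edges d s (v : 'I_s.+1 -> 'rV[R]_d) : 'M[R]_(s, d) :=
  \matrix_(i < s) (v (lift ord0 i) - v ord0).

Definition nondegenerate_simplex d s (v : 'I_s.+1 -> 'rV[R]_d) : Prop :=
  row_free (edges v).

Definition in_simplex d s (v : 'I_s.+1 -> 'rV[R]_d) (x : 'rV[R]_d) : Prop :=
  exists l : 'I_s.+1 -> R,
    [/\ forall i, 0 <= l i, \sum_i l i = 1 & x = \sum_i l i *: v i].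

(* The Lebesgue integral of f over {t in R^s | t_i >= 0, sum_i t_i <= c}, as an
   iterated integral. *)
Fixpoint ref_int (s : nat) : R -> ('rV[R]_s -> R) -> R :=
  match s with
  | 0 => fun _ f => f 0
  | s'.+1 => fun c f =>
      Rintegral (@lebesgue_measure R) [set t : R | 0 <= t <= c]%classic
        (fun t : R =>
           ref_int (c - t) (fun u : 'rV[R]_s' => f (row_mx (t%:M : 'M_1) u)))
  end.

(* The integral over the s-simplex with vertices v with respect to s-dimensional
   surface measure, through the affine parametrization by the reference simplex
   and its Gram determinant. *)
Definition simplex_int d s (v : 'I_s.+1 -> 'rV[R]_d) (f : 'rV[R]_d -> R) : R :=
  Num.sqrt (\det (edges v *m (edges v)^T)) *
  ref_int 1 (fun t : 'rV[R]_s => f (v ord0 + t *m edges v)).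

Definition ip d s (v : 'I_s.+1 -> 'rV[R]_d) (f g : 'rV[R]_d -> R) : R :=
  simplex_int v (fun x => f x * g x).

Definition ipM d s m n (v : 'I_s.+1 -> 'rV[R]_d)
    (f g : 'rV[R]_d -> 'M[R]_(m, n)) : R :=
  simplex_int v (fun x => \tr ((f x)^T *m g x)).

(* Faces of codimension r of a d-simplex, given by their sets of vertices. *)
Definition faces (d r : nat) : {set {set 'I_d.+1}} :=
  [set F : {set 'I_d.+1} | #|F| == (d - r).+1].

Definition face_vtx d (a : 'I_d.+1 -> 'rV[R]_d) (r : nat) (F : {set 'I_d.+1}) :
    'I_(d - r).+1 -> 'rV[R]_d :=
  fun i => a (nth ord0 (enum F) i).

(* The rows of N are an orthonormal basis of the orthogonal complement of the
   tangent space of the simplex v. *)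
Definition normal_frame d s r (v : 'I_s.+1 -> 'rV[R]_d) (N : 'M[R]_(r, d)) :
    Prop :=
  N *m N^T = 1%:M /\ (N == kermx (edges v)^T)%MS.

(* o is a point of the affine hull of v, and the rows of T are an orthonormal
   basis of its tangent space. *)
Definition cartesian_frame d s (v : 'I_s.+1 -> 'rV[R]_d)
    (o : 'rV[R]_d) (T : 'M[R]_(s, d)) : Prop :=
  [/\ T *m T^T = 1%:M, (T == edges v)%MS & (o - v ord0 <= edges v)%MS].

Definition cart_coord d s (o : 'rV[R]_d) (T : 'M[R]_(s, d)) (x : 'rV[R]_d) :
    'rV[R]_s :=
  (x - o) *m T^T.

End Simplices.

Section DegreesOfFreedom.
Variables (R : realType) (d : nat) (a : 'I_d.+1 -> 'rV[R]_d).
Variable tau : 'M[{mpoly R[d]}]_d.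

Definition dof_vertex (delta : 'I_d.+1) : 'M[R]_d := evM tau (a delta).

Section Face.
Variables (r : nat) (F : {set 'I_d.+1}).
Variables (o : 'rV[R]_d) (T : 'M[R]_(d - r, d)).

Definition dof_nn (N : 'M[R]_(r, d)) (i j : 'I_r) (q : {mpoly R[d - r]}) : R :=
  ip (face_vtx a (r := r) F)
     (ev ((cstM d N *m tau *m cstM d N^T) i j))
     (fun x => ev q (cart_coord o T x)).

(* The tangential vector with coordinates q is T^T *m q. *)
Definition dof_tn (n : 'rV[R]_d) (q : 'cV[{mpoly R[d - r]}]_(d - r)) : R :=
  ipM (face_vtx a (r := r) F)
      (evM (PiF n (tau *m cstM d n^T)))
      (fun x => T^T *m evM q (cart_coord o T x)).

Definition dof_trace (n : 'rV[R]_d) (p : {mpoly R[d - r]}) : R :=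
  ip (face_vtx a (r := r) F)
     (ev ((cstM d n *m row_div tau) 0 0 + divF T (tau *m cstM d n^T)))
     (fun x => ev p (cart_coord o T x)).

End Face.

Definition dof_int (sigma : 'M[{mpoly R[d]}]_d) : R :=
  ipM a (evM tau) (evM sigma).

End DegreesOfFreedom.

(* The normal-normal families count only pairs i <= j, and vertex values only
   the entries of a symmetric matrix. *)
Definition ndofs (R : realType) (d k : nat) : nat :=
  (d.+1 * (d * d.+1)./2
   + \sum_(1 <= r < d)
       #|faces d r| * ((r * r.+1)./2 * polydim (@Pol R (d - r) (k + r - d.+1)))
   + #|faces d 1| * polydim (@ND R (d - 1) (k - 2))
   + #|faces d 1| * polydim (@Pol R (d - 1) (k - 1))
   + polydim (@defND R d (k - 3))
   + polydim (@ker_x_PolSym R d (k - 2)))%N.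

(* Main.v *)
(* Uniqueness.  By induction on the dimension of a face F, n1^T tau n2 vanishes on F
   for all normals n1, n2 of F: it vanishes on the boundary, so on F it is a multiple
   of the product of the barycentric coordinates of F, and its moments kill the other
   factor.  On a facet the field Pi_F tau n therefore has vanishing normal trace on
   the boundary.  Such a field u in P_m is determined by its moments against ND_{m-2}:
   orthogonality to gradients gives div u = 0, hence orthogonality to all gradients,
   and P_{m-1} is the sum of ND_{m-2} and gradients by Euler's identity
   m q = grad(q.x) + (grad q - grad q^T) x for q homogeneous of degree m - 1; writing
   g_j.u = lam_j phi_j, with g_j the gradient of the barycentric coordinate lam_j, and
   testing with sum_j phi_j g_j yields a sum of squares.  So tau n = 0, and then
   n.div tau = 0, on all facets.  Since (tau, def q) = -(div tau, q), the same
   argument gives div tau = 0, so tau is orthogonal to all def q; by the identity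
   2 def(q) x = (m-1) q + grad(q.x) for q homogeneous of degree m, the fields def q and
   the kernel of tau |-> tau x span P_{k-2}(S), and tau = 0 follows by testing with
   sum_{i<>j} phi_ij g_i^T g_j, where g_i^T tau g_j = lam_i lam_j phi_ij.

   Counting.  ND_m is the kernel in P_{m+1} of q |-> (part of degree m + 2 of q.x), which
   maps onto the homogeneous polynomials; the rigid motions cancel between the two
   interior families, and the boundary families are summed by Vandermonde's
   convolution. *)
Require Import Defs.
From HB Require Import structures.
From mathcomp Require Import all_boot all_order all_algebra.
From mathcomp.multinomials Require Import ssrcomplements mpoly.
From mathcomp Require Import polyrcf.
From mathcomp Require Import zify ring.
From mathcomp Require Import boolp classical_sets reals constructive_ereal topology.
From mathcomp Require Import normedtype derive realfun measure lebesgue_measure lebesgue_integral.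
From mathcomp Require Import lebesgue_Rintegral ftc.

Set Implicit Arguments.
Unset Strict Implicit.
Unset Printing Implicit Defensive.

Import Order.TTheory GRing.Theory Num.Theory.
Import numFieldNormedType.Exports.
Local Open Scope ring_scope.

(** * Polynomials *)

Section MpolyFacts.
Variable R : realType.

Lemma mpoly_ring_ind s (P : {mpoly R[s]} -> Prop) :
  (forall c, P c%:MP) -> (forall i, P 'X_i) ->
  (forall p q, P p -> P q -> P (p + q)) ->
  (forall p q, P p -> P q -> P (p * q)) -> forall p, P p.
Proof.
move=> PC PX PD PM p.
have P0 : P 0 by rewrite -(mpolyC0 s R); exact: PC.
have PXm m : P 'X_[m].
  rewrite mpolyXE_id; elim/big_ind: _ => //; first by rewrite -mpolyC1.
  move=> i _; elim: (m i) => [|e IH]; first by rewrite expr0 -mpolyC1.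
  by rewrite exprS; apply: PM.
elim/mpolyind: p => // c m p _ _ Pp; apply: PD => //.
by rewrite -mul_mpolyC; apply: PM.
Qed.

Lemma ev_add s (p q : {mpoly R[s]}) x : ev (p + q) x = ev p x + ev q x.
Proof. by rewrite /ev mevalD. Qed.
Lemma ev_opp s (p : {mpoly R[s]}) x : ev (- p) x = - ev p x.
Proof. by rewrite /ev mevalN. Qed.
Lemma ev_mul s (p q : {mpoly R[s]}) x : ev (p * q) x = ev p x * ev q x.
Proof. by rewrite /ev mevalM. Qed.
Lemma ev_const s c (x : 'rV[R]_s) : ev c%:MP x = c.
Proof. by rewrite /ev mevalC. Qed.
Lemma ev_X s i (x : 'rV[R]_s) : ev 'X_i x = x 0 i.
Proof. by rewrite /ev mevalXU. Qed.
Lemma ev0 s (x : 'rV[R]_s) : ev 0 x = 0.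
Proof. by rewrite /ev meval0. Qed.
Lemma ev1 s (x : 'rV[R]_s) : ev 1 x = 1.
Proof. by rewrite /ev meval1. Qed.
Lemma ev_sum s I (r : seq I) P (F : I -> {mpoly R[s]}) x :
  ev (\sum_(i <- r | P i) F i) x = \sum_(i <- r | P i) ev (F i) x.
Proof. by rewrite /ev raddf_sum. Qed.
Lemma ev_prod s I (r : seq I) P (F : I -> {mpoly R[s]}) x :
  ev (\prod_(i <- r | P i) F i) x = \prod_(i <- r | P i) ev (F i) x.
Proof. by rewrite /ev rmorph_prod. Qed.

(** Pullback along the affine map [x |-> o + x *m T]. It serves to restrict polynomials to faces and
    slices and to project onto hyperplanes. *)
Definition aff d s (o : 'rV[R]_d) (T : 'M[R]_(s, d)) (p : {mpoly R[d]}) :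
    {mpoly R[s]} :=
  p \mPo [tuple (o 0 i)%:MP + \sum_j (T j i)%:MP * 'X_j | i < d].

HB.instance Definition _ d s o T :=
  GRing.RMorphism.copy (@aff d s o T) (comp_mpoly _).

Lemma affC d s o T c : @aff d s o T c%:MP = c%:MP.
Proof. exact: comp_mpolyC. Qed.

Lemma affX d s o T i :
  @aff d s o T 'X_i = (o 0 i)%:MP + \sum_j (T j i)%:MP * 'X_j.
Proof. by rewrite /aff comp_mpolyXU -tnth_nth tnth_mktuple. Qed.

Lemma ev_aff d s o T p x : ev (@aff d s o T p) x = ev p (o + x *m T).
Proof.
elim/mpoly_ring_ind: p => [c|i|p q IHp IHq|p q IHp IHq].
- by rewrite affC !ev_const.
- rewrite affX ev_add ev_const ev_sum ev_X !mxE; congr (_ + _).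
  by apply: eq_bigr => j _; rewrite ev_mul ev_const ev_X mulrC.
- by rewrite rmorphD /= !ev_add IHp IHq.
- by rewrite rmorphM /= !ev_mul IHp IHq.
Qed.

Lemma PolP s m (p : {mpoly R[s]}) :
  Pol m p <-> forall mm, (m < mdeg mm)%N -> p@_mm = 0.
Proof.
rewrite /Pol; split=> [h mm lt|h].
  by apply/eqP; rewrite mcoeff_eq0 msize_mdeg_ge // (leq_trans h).
rewrite msizeE; apply/bigmax_leqP_seq => mm mmp _; rewrite ltnNge.
by apply/negP => /h /eqP; rewrite mcoeff_eq0 mmp.
Qed.

Lemma Pol0 s m : @Pol R s m 0.
Proof. by rewrite /Pol msize0. Qed.
Lemma PolC s m c : @Pol R s m c%:MP.
Proof. by rewrite /Pol msizeC; case: (c != 0). Qed.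
Lemma PolD s m (p q : {mpoly R[s]}) : Pol m p -> Pol m q -> Pol m (p + q).
Proof.
by rewrite /Pol => hp hq; rewrite (leq_trans (msizeD_le _ _)) // geq_max hp.
Qed.
Lemma PolN s m (p : {mpoly R[s]}) : Pol m p -> Pol m (- p).
Proof. by rewrite /Pol msizeN. Qed.
Lemma PolB s m (p q : {mpoly R[s]}) : Pol m p -> Pol m q -> Pol m (p - q).
Proof. by move=> hp hq; apply/PolD => //; apply/PolN. Qed.
Lemma Pol_sum s m I (r : seq I) (P : pred I) (F : I -> {mpoly R[s]}) :
  (forall i, P i -> Pol m (F i)) -> Pol m (\sum_(i <- r | P i) F i).
Proof.
move=> h; elim/big_ind: _ => // [|p q]; [exact: Pol0|exact: PolD].
Qed.
Lemma Pol_mul s m n (p q : {mpoly R[s]}) : Pol m p -> Pol n q -> Pol (m + n) (p * q).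
Proof.
rewrite /Pol => hp hq.
have [->|p0] := eqVneq p 0; first by rewrite mul0r msize0.
have [->|q0] := eqVneq q 0; first by rewrite mulr0 msize0.
rewrite msizeM //; move: (leq_add hp hq); rewrite addSn addnS.
by case: (_ + _)%N.
Qed.
Lemma Pol_le s m n (p : {mpoly R[s]}) : (m <= n)%N -> Pol m p -> Pol n p.
Proof. by rewrite /Pol => le h; apply: leq_trans h _. Qed.
Lemma Pol_CM s m c (p : {mpoly R[s]}) : Pol m p -> Pol m (c%:MP * p).
Proof. by move=> h; rewrite -[m]add0n; apply: Pol_mul => //; apply: PolC. Qed.
Lemma Pol_X s (mm : 'X_{1..s}) : Pol (mdeg mm) 'X_[R, mm].
Proof. by rewrite /Pol msizeX. Qed.
Lemma Pol_XU s (i : 'I_s) : @Pol R s 1 'X_i.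
Proof. by rewrite /Pol msizeX mdeg1. Qed.
Lemma Pol_mderiv s m i (p : {mpoly R[s]}) : Pol m.+1 p -> Pol m (mderiv i p).
Proof.
move=> /PolP h; apply/PolP => mm lt; rewrite mcoeff_mderiv h ?mul0rn //.
by rewrite mdegD mdeg1 addn1.
Qed.
(** Degrees add over a domain; the bound on [msize p] says that [p] has degree at least [n]. *)
Lemma Pol_factor s m n (p q : {mpoly R[s]}) :
  p != 0 -> (n.+1 <= msize p)%N -> Pol (m + n) (p * q) -> Pol m q.
Proof.
rewrite /Pol => p0 hp; have [->|q0] := eqVneq q 0; first by rewrite msize0.
rewrite msizeM //; case: (msize p) hp => // t; rewrite addSn ltnS /= => hp h.
by rewrite -(leq_add2r n) (leq_trans _ h) // addnC leq_add2r.
Qed.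

Lemma Pol_aff d s o T m (p : {mpoly R[d]}) : Pol m p -> Pol m (@aff d s o T p).
Proof.
move=> /PolP h; rewrite (mpolyE p) raddf_sum /= big_seq.
apply: Pol_sum => mm; rewrite mcoeff_msupp => mmp.
rewrite -mul_mpolyC rmorphM /= affC; apply: Pol_CM.
have le : (mdeg mm <= m)%N.
  by rewrite leqNgt; apply: contra mmp => /h ->; rewrite eqxx.
apply: Pol_le le _; rewrite mpolyXE_id rmorph_prod mdegE /=.
apply: (big_ind2 (fun (p : {mpoly R[s]}) n => Pol n p)) => //.
- by rewrite -mpolyC1; apply: PolC.
- by move=> ? ? ? ?; apply: Pol_mul.
move=> i _; rewrite rmorphXn /= affX; elim: (mm i) => [|e IH].
  by rewrite expr0 -mpolyC1; apply: PolC.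
rewrite exprS -add1n; apply: Pol_mul => //; apply: PolD; first exact: PolC.
by apply: Pol_sum => j _; apply: Pol_CM; apply: Pol_XU.
Qed.

Lemma mderivXU s (i j : 'I_s) : mderiv i 'X_j = (i == j)%:R :> {mpoly R[s]}.
Proof.
rewrite mderivX mnm1E eq_sym; case: eqP => [->|_]; last by rewrite scale0r.
rewrite scale1r -mpolyX0; congr 'X_[_].
by apply/mnmP => t; rewrite mnmBE subnn mnm0E.
Qed.

(** Chain rule: the derivative along row [i] of [T] becomes a partial derivative. Both sides are
    additive and obey Leibniz' rule, so constants and variables suffice. *)
Lemma aff_mderiv d s o T i (p : {mpoly R[d]}) :
  @aff d s o T (\sum_j (T i j)%:MP * mderiv j p) = mderiv i (aff o T p).
Proof.
elim/mpoly_ring_ind: p => [c|l|p q IHp IHq|p q IHp IHq].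
- by rewrite affC mderivC big1 ?rmorph0 // => j _; rewrite mderivC mulr0.
- rewrite affX mderivD mderivC add0r !raddf_sum (bigD1 l) //= (bigD1 i) //=.
  rewrite mderivXU mderiv_mulC mderivXU !eqxx !mulr1 affC !big1 ?addr0 //.
    by move=> j jl; rewrite mderiv_mulC mderivXU eq_sym (negPf jl) mulr0.
  by move=> j jl; rewrite mderivXU (negPf jl) mulr0 rmorph0.
- rewrite rmorphD /= mderivD -IHp -IHq -rmorphD /= -big_split; congr aff.
  by apply: eq_bigr => j _; rewrite mderivD mulrDr.
- rewrite rmorphM /= mderivM -IHp -IHq -!rmorphM -rmorphD /=; congr aff.
  rewrite mulr_suml mulr_sumr -big_split; apply: eq_bigr => j _.
  by rewrite mderivM mulrDr !mulrA /= [p * _]mulrC.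
Qed.

(** The linear extension of [w] from monomials. Integrals and boundary functionals are defined this
    way, which reduces their identities to monomials. *)
Definition monom_lin s (U : lmodType R) (w : 'X_{1..s} -> U) (p : {mpoly R[s]}) : U :=
  \sum_(m <- msupp p) p@_m *: w m.

Lemma monom_linwE s U w k (p : {mpoly R[s]}) : (msize p <= k)%N ->
  @monom_lin s U w p = \sum_(m : 'X_{1..s < k}) p@_m *: w m.
Proof.
move=> lt_pk; pose I : subFinType _ := 'X_{1..s < k}.
rewrite /monom_lin (big_mksub I) //=; first last.
+ by move=> x /msize_mdeg_lt /leq_trans /(_ lt_pk) ->.
+ by rewrite msupp_uniq.
rewrite big_rmcond //= => m /memN_msupp_eq0 ->.
by rewrite scale0r.
Qed.

Lemma monom_lin_is_linear s U w : linear (@monom_lin s U w).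
Proof.
move=> c p q; set k := maxn (msize (c *: p + q)) (maxn (msize p) (msize q)).
rewrite !(@monom_linwE _ _ _ k) /k ?leq_max ?leqnn ?orbT //.
rewrite scaler_sumr -big_split; apply: eq_bigr => m _ /=.
by rewrite mcoeffD mcoeffZ scalerDl scalerA.
Qed.

HB.instance Definition _ s (U : lmodType R) w :=
  GRing.isLinear.Build R {mpoly R[s]} U _ (@monom_lin s U w) (@monom_lin_is_linear s U w).

Lemma monom_linX s (U : lmodType R) w (m : 'X_{1..s}) : @monom_lin s U w 'X_[m] = w m.
Proof. by rewrite /monom_lin msuppX big_seq1 mcoeffX eqxx scale1r. Qed.

Lemma mpoly_add_ind s (P : {mpoly R[s]} -> Prop) :
  (forall c m, P (c *: 'X_[m])) -> (forall p q, P p -> P q -> P (p + q)) ->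
  forall p, P p.
Proof.
move=> PX PD; elim/mpolyind => [|c m p _ _ Pp]; last exact: PD.
by rewrite -(scale0r 'X_[0]).
Qed.

Lemma cstM_mul s m n p (A : 'M[R]_(m, n)) (B : 'M[R]_(n, p)) :
  cstM s (A *m B) = cstM s A *m cstM s B.
Proof. exact: (map_mxM (@mpolyC s R)). Qed.

Lemma cstMD s m n (A B : 'M[R]_(m, n)) : cstM s (A + B) = cstM s A + cstM s B.
Proof. exact: (map_mxD (@mpolyC s R)). Qed.

Lemma cstM0 s m n : cstM s (0 : 'M[R]_(m, n)) = 0.
Proof. exact: (map_mx0 (@mpolyC s R)). Qed.

Lemma cstMN s m n (A : 'M[R]_(m, n)) : cstM s (- A) = - cstM s A.
Proof. exact: (map_mxN (@mpolyC s R)). Qed.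

Lemma cstM_sum s m n I (r : seq I) (P : pred I) (F : I -> 'M[R]_(m, n)) :
  cstM s (\sum_(i <- r | P i) F i) = \sum_(i <- r | P i) cstM s (F i).
Proof. by elim/big_ind2: _ => [|A B C D <- <-|//]; rewrite ?cstM0 ?cstMD. Qed.

Lemma cstM1 s n : cstM s (1%:M : 'M[R]_n) = 1%:M.
Proof. exact: (map_mx1 (@mpolyC s R)). Qed.

Lemma cstM_tr s m n (A : 'M[R]_(m, n)) : cstM s A^T = (cstM s A)^T.
Proof. by rewrite /cstM map_trmx. Qed.

Lemma evM_mul s m n p (A : 'M[{mpoly R[s]}]_(m, n)) (B : 'M_(n, p)) x :
  evM (A *m B) x = evM A x *m evM B x.
Proof. exact: (map_mxM (meval (fun i => x 0 i))). Qed.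

Lemma evM_cst s m n (A : 'M[R]_(m, n)) (x : 'rV_s) : evM (cstM s A) x = A.
Proof. by apply/matrixP => i j; rewrite !mxE ev_const. Qed.

Lemma evM_tr s m n (A : 'M[{mpoly R[s]}]_(m, n)) x : evM A^T x = (evM A x)^T.
Proof. by rewrite /evM map_trmx. Qed.

Lemma ev_tr s n (A : 'M[{mpoly R[s]}]_n) x : ev (\tr A) x = \tr (evM A x).
Proof. by rewrite /mxtrace ev_sum; apply: eq_bigr => i _; rewrite mxE. Qed.

End MpolyFacts.

(** * Integration over the reference simplex *)

Section PolyIntegral.
Variable R : realType.
Implicit Types (G H : {poly R}) (c : R).

(** The antiderivative vanishing at 0; its constant coefficient is 0 because division by zero yields
    0. *)
Definition pint G : {poly R} := \poly_(i < (size G).+1) (G`_i.-1 / i%:R).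

Lemma coef_pint G i : (pint G)`_i = G`_i.-1 / i%:R.
Proof.
rewrite coef_poly; case: i => [|i] /=; first by rewrite invr0 mulr0.
by rewrite ltnS; case: ltnP => // h; rewrite nth_default // mul0r.
Qed.

Lemma deriv_pint G : (pint G)^`() = G.
Proof.
apply/polyP => i; rewrite coef_deriv coef_pint /= -[LHS]mulr_natr divfK //.
by rewrite pnatr_eq0.
Qed.

Lemma pint_deriv G : pint G^`() = G - (G`_0)%:P.
Proof.
apply/polyP => -[|i]; rewrite coef_pint coefB coefC ?invr0 ?mulr0 ?subrr //=.
by rewrite subr0 coef_deriv -[X in X / _]mulr_natr mulfK // pnatr_eq0.
Qed.

Lemma pint_is_linear : linear pint.
Proof.
move=> a G H; apply/polyP => i; rewrite coefD coefZ !coef_pint coefD coefZ.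
by rewrite mulrDl mulrA.
Qed.

HB.instance Definition _ := GRing.isLinear.Build R {poly R} {poly R} _ pint
  pint_is_linear.

Lemma pint0 G : (pint G).[0] = 0.
Proof. by rewrite horner_coef0 coef_pint invr0 mulr0. Qed.

Lemma Rintegral_horner G c : 0 <= c ->
  Rintegral (@lebesgue_measure R) [set t : R | 0 <= t <= c]%classic (horner G) =
  (pint G).[c].
Proof.
rewrite le_eqVlt => /orP[/eqP <-|c0].
  have -> : [set t : R | 0 <= t <= 0]%classic = [set (0 : R)]%classic.
    apply/seteqP; split => t /=; first by rewrite -eq_le => /eqP.
    by move=> ->; rewrite lexx.
  by rewrite Rintegral_set1 pint0.
have -> : [set t : R | 0 <= t <= c]%classic = `[0, c]%classic.
  by apply/seteqP; split => t /=; rewrite in_itv.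
rewrite /Rintegral (@continuous_FTC2 _ _ (horner (pint G))) //.
- by rewrite pint0 -EFinB subr0.
- exact/continuous_subspaceT/continuous_horner.
- split.
  + by move=> x _; exact: derivable_horner.
  + exact/cvg_at_right_filter/continuous_horner.
  + exact/cvg_at_left_filter/continuous_horner.
- by move=> x _; rewrite -derivE deriv_pint.
Qed.

(** Euler's beta integral, by induction on [b]. *)
Lemma pint_beta c a b :
  (pint ('X^a * (c%:P - 'X) ^+ b)).[c] =
  (a`! * b`!)%:R / (a + b).+1`!%:R * c ^+ (a + b).+1.
Proof.
elim: b a => [|b IH] a.
  rewrite expr0 mulr1 addn0 muln1.
  have -> : pint 'X^a = (a.+1%:R^-1) *: 'X^(a.+1).
    apply/polyP => -[|i]; rewrite coef_pint coefZ !coefXn /= ?invr0 ?mulr0 //.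
    by rewrite eqSS; case: eqP => [->|_]; rewrite ?mul1r ?mulr1 ?mul0r ?mulr0.
  rewrite hornerZ hornerXn factS natrM; congr (_ * _).
  by rewrite invfM mulrCA mulfV ?mulr1 // pnatr_eq0 -lt0n fact_gt0.
(* Integration by parts: the derivative on the right contributes nothing, since
   [X^(a+1) (c - X)^(b+1)] vanishes at 0 and at [c]. *)
have e : 'X^a * (c%:P - 'X) ^+ b.+1 =
   (a.+1%:R)^-1 *: (('X^(a.+1) * (c%:P - 'X) ^+ b.+1)^`() +
     b.+1%:R *: ('X^(a.+1) * (c%:P - 'X) ^+ b)) :> {poly R}.
  rewrite derivM derivXn deriv_exp derivB derivC derivX sub0r /=.
  rewrite mulN1r mulNrn mulrN mulrnAr scaler_nat subrK mulrnAl.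
  by rewrite -[X in _ *: X]scaler_nat scalerA mulVf ?scale1r // pnatr_eq0.
rewrite e linearZ linearD linearZ /= pint_deriv hornerZ hornerD hornerZ IH.
rewrite hornerD hornerN hornerC -horner_coef0 !hornerM !horner_exp.
rewrite !(hornerD, hornerN, hornerX, hornerC).
rewrite subrr !expr0n /= mulr0 add0r oppr0 ?mul0r ?mulr0 ?subr0 ?oppr0 ?add0r.
have assoc (x y n1 n2 D C : R) :
  x * (y * n1) = n2 -> x * (y * (n1 / D * C)) = n2 / D * C.
  by move=> <-; rewrite !mulrA.
rewrite addSnnS. apply: assoc.
rewrite -natrM (_ : b.+1 * _ = a.+1 * (a`! * b.+1`!))%N.
  by rewrite natrM mulKf // pnatr_eq0.
by rewrite !factS mulnCA !mulnA.
Qed.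

Lemma poly_eq0_itv G c : 0 < c -> (forall t, 0 < t -> t < c -> G.[t] = 0) -> G = 0.
Proof.
move=> c0 h; apply/eqP/negPn/negP => G0.
(* The points [c / (i + 2)] are distinct, lie strictly inside the interval and number [size G], more
   than the roots a nonzero [G] can have. *)
pose rs := [seq c / i.+2%:R | i <- iota 0 (size G)].
have := @max_poly_roots _ G rs G0; rewrite size_map size_iota ltnn => H.
suff : false by []. apply: H.
- apply/allP => _ /mapP[i _ ->]; rewrite /root h ?divr_gt0 //.
  by rewrite ltr_pdivrMr // ltr_pMr // ltr1n.
- rewrite map_inj_uniq ?iota_uniq // => i j /(mulfI (lt0r_neq0 c0)) /invr_inj.
  by move/eqP; rewrite eqr_nat => /eqP [].
Qed.

Lemma pint_ge0 G c : 0 <= c -> (forall t, 0 <= t -> t <= c -> 0 <= G.[t]) ->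
  0 <= (pint G).[c].
Proof.
move=> c0 h; rewrite -(pint0 G); apply: (@ler_hornerW _ 0 c) => //.
- by move=> x; rewrite in_itv /= deriv_pint => /andP[/ltW x0 /ltW xc]; apply: h.
- by rewrite in_itv /= lexx.
- by rewrite in_itv /= lexx c0.
Qed.

(** The antiderivative is monotone on the interval and 0 at both ends, so it vanishes throughout the
    interval and hence identically. *)
Lemma pint_eq0 G c : 0 < c -> (forall t, 0 <= t -> t <= c -> 0 <= G.[t]) ->
  (pint G).[c] = 0 -> G = 0.
Proof.
move=> c0 h i0; rewrite -(deriv_pint G).
suff -> : pint G = 0 by rewrite deriv0.
have mono : {in `[0, c] &, {homo horner (pint G) : x y / x <= y}}.
  apply: ler_hornerW => x; rewrite in_itv /= deriv_pint => /andP[/ltW x0 /ltW xc].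
  exact: h.
apply: (@poly_eq0_itv _ c) => // t t0 tc; apply/eqP; rewrite eq_le.
rewrite -{1}i0 -(pint0 G) !mono // ?in_itv /= ?lexx ?(ltW t0) ?(ltW tc) ?(ltW c0) //.
Qed.

End PolyIntegral.

(** * Dirichlet's formula, positivity and boundary terms on the reference simplex *)

Section ReferenceSimplex.
Variable R : realType.

Definition mtail s (m : 'X_{1..s.+1}) : 'X_{1..s} :=
  [multinom m (lift ord0 i) | i < s].

Lemma mdeg_tail s (m : 'X_{1..s.+1}) : mdeg m = (m ord0 + mdeg (mtail m))%N.
Proof.
rewrite !mdegE big_ord_recl; congr (_ + _)%N.
by apply: eq_bigr => i _; rewrite mnmE.
Qed.

Lemma mtail_inj s (m m' : 'X_{1..s.+1}) :
  mtail m = mtail m' -> m ord0 = m' ord0 -> m = m'.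
Proof.
move=> /mnmP e e0; apply/mnmP => i; case: (unliftP ord0 i) => [j|] -> //.
by have := e j; rewrite !mnmE.
Qed.

Definition mfact s (m : 'X_{1..s}) : nat := (\prod_(i < s) (m i)`!)%N.

Lemma mfact_tail s (m : 'X_{1..s.+1}) : mfact m = ((m ord0)`! * mfact (mtail m))%N.
Proof.
rewrite /mfact big_ord_recl; congr (_ * _)%N.
by apply: eq_bigr => i _; rewrite mnmE.
Qed.

Lemma mfactU s i (m : 'X_{1..s}) : mfact (U_(i) + m)%MM = ((m i).+1 * mfact m)%N.
Proof.
rewrite /mfact (bigD1 i) //= [in RHS](bigD1 i) //= mnmDE mnm1E eqxx factS mulnA.
congr (_ * _)%N; apply: eq_bigr => j ji.
by rewrite mnmDE mnm1E eq_sym (negPf ji).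
Qed.

(** Fixes the first coordinate at [t], as the outer integral in [ref_int] does. *)
Definition slice s (t : R) : {mpoly R[s.+1]} -> {mpoly R[s]} :=
  @aff R (1 + s) s (row_mx t%:M 0) (row_mx 0 1%:M).

HB.instance Definition _ s t :=
  GRing.RMorphism.copy (@slice s t) (@aff R (1 + s) s _ _).

Lemma ev_slice s t (p : {mpoly R[s.+1]}) u :
  ev (slice t p) u = ev p (row_mx (t%:M : 'M_1) u).
Proof.
rewrite ev_aff mul_mx_row mulmx0 mulmx1; congr ev.
by rewrite add_row_mx add0r addr0.
Qed.

Lemma sliceC s t c : @slice s t c%:MP = c%:MP.
Proof. exact: affC. Qed.

Lemma slice_is_scalable s t : scalable (@slice s t).
Proof. by move=> c p; rewrite -!mul_mpolyC rmorphM /= sliceC. Qed.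

HB.instance Definition _ s t :=
  GRing.isScalable.Build R {mpoly R[s.+1]} {mpoly R[s]} _ (@slice s t)
   (@slice_is_scalable s t).

Lemma sliceX s t (m : 'X_{1..s.+1}) :
  slice t 'X_[m] = t ^+ (m ord0) *: 'X_[mtail m].
Proof.
rewrite mpolyXE_id rmorph_prod /= big_ord_recl rmorphXn /= -mul_mpolyC.
congr (_ * _).
  rewrite /slice affX (_ : ord0 = lshift s ord0 :> 'I_(1+s)); last exact/val_inj.
  rewrite big1 ?addr0; first by rewrite row_mxEl mxE eqxx rmorphXn.
  by move=> j _; rewrite row_mxEl mxE mul0r.
rewrite mpolyXE_id; apply: eq_bigr => i _; rewrite mnmE rmorphXn /=; congr (_ ^+ _).
rewrite /slice affX (_ : lift ord0 i = rshift 1 i :> 'I_(1+s)); last exact/val_inj.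
rewrite row_mxEr mxE add0r (bigD1 i) //= big1 ?addr0.
  by rewrite row_mxEr mxE eqxx mul1r.
by move=> j ji; rewrite row_mxEr mxE (negPf ji) mul0r.
Qed.

(* Dirichlet's formula for the integral of a monomial over the simplex
   {t >= 0, sum t <= c}. *)
Definition Lint s (c : R) (p : {mpoly R[s]}) : R :=
  monom_lin (fun m => (mfact m)%:R / ((mdeg m + s)`!)%:R * c ^+ (mdeg m + s) : R^o) p.

Lemma Lint_is_scalar s c : scalar (@Lint s c).
Proof. exact: monom_lin_is_linear. Qed.

HB.instance Definition _ s c :=
  GRing.isLinear.Build R {mpoly R[s]} R _ (@Lint s c) (@Lint_is_scalar s c).

Lemma LintX s c m : @Lint s c 'X_[m] =
  (mfact m)%:R / ((mdeg m + s)`!)%:R * c ^+ (mdeg m + s).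
Proof. exact: monom_linX. Qed.

(** The Dirichlet integral of the slice at [t] over the simplex of size [c - t], as a univariate
    polynomial in [t]. It turns the outer integral into [pint]. *)
Definition sectional s c (p : {mpoly R[s.+1]}) : {poly R} :=
  monom_lin (fun m => ((mfact (mtail m))%:R / ((mdeg (mtail m) + s)`!)%:R) *:
     ('X^(m ord0) * (c%:P - 'X) ^+ (mdeg (mtail m) + s)) : {poly R}) p.

HB.instance Definition _ s c := GRing.Linear.copy (@sectional s c) (monom_lin _).

Lemma sectionalX s c m : @sectional s c 'X_[m] =
 ((mfact (mtail m))%:R / ((mdeg (mtail m) + s)`!)%:R) *:
     ('X^(m ord0) * (c%:P - 'X) ^+ (mdeg (mtail m) + s)).
Proof. exact: monom_linX. Qed.

Lemma horner_sectional s c t (p : {mpoly R[s.+1]}) :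
  (sectional c p).[t] = Lint (c - t) (slice t p).
Proof.
elim/mpoly_add_ind: p => [e m|p q IHp IHq]; last first.
  by rewrite !linearD hornerD /= IHp IHq.
rewrite !linearZ /= hornerZ sliceX linearZ /= LintX sectionalX.
rewrite hornerZ hornerM !horner_exp !(hornerD, hornerN, hornerX, hornerC).
congr (_ * _); exact: mulrCA.
Qed.

(** On a monomial this is the beta integral; the factorial [(mdeg (mtail m) + s)!] cancels. *)
Lemma Lint_sectional s c (p : {mpoly R[s.+1]}) :
  Lint c p = (pint (sectional c p)).[c].
Proof.
elim/mpoly_add_ind: p => [e m|p q IHp IHq]; last first.
  by rewrite !linearD hornerD /= IHp IHq.
rewrite !linearZ /= hornerZ LintX sectionalX.
rewrite linearZ /= hornerZ pint_beta; congr (_ * _).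
rewrite mfact_tail mdeg_tail addnS -addnA !natrM !mulrA; congr (_ * _).
have key (x M D N : R) : D != 0 -> x * M / N = M / D * x * D / N.
  by move=> D0; rewrite [M / D * x]mulrAC mulfVK // [M * x]mulrC.
by apply: key; rewrite pnatr_eq0 -lt0n fact_gt0.
Qed.

(** By induction on the dimension the inner integral is the value of [sectional c p] at [t], so only
    an integral of a univariate polynomial remains. *)
Lemma ref_int_ev s c (p : {mpoly R[s]}) : 0 <= c -> ref_int c (ev p) = Lint c p.
Proof.
elim: s c p => [|s IH] c p c0 /=.
  elim/mpoly_add_ind: p => [e m|p q IHp IHq]; last first.
    by rewrite ev_add IHp IHq linearD.
  rewrite linearZ /= LintX -mul_mpolyC ev_mul ev_const; congr (_ * _).
  rewrite /ev mevalX big_ord0 /mfact big_ord0 mdegE big_ord0 /=.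
  by rewrite expr0 invr1 !mulr1.
rewrite Lint_sectional -Rintegral_horner //.
apply: eq_Rintegral => t; rewrite inE => t0c.
have /andP[t0 tc] : 0 <= (t : R) <= c by [].
transitivity (sectional c p).[t : R]; last by [].
rewrite horner_sectional -IH ?subr_ge0 //; congr ref_int.
by apply/funext => u; rewrite ev_slice.
Qed.

Definition in_ref s c (x : 'rV[R]_s) := (forall i, 0 <= x 0 i) /\ \sum_i x 0 i <= c.

Lemma in_ref_slice s c t (u : 'rV[R]_s) : 0 <= t ->
  in_ref (c - t) u -> @in_ref s.+1 c (row_mx (t%:M : 'M_1) u).
Proof.
move=> t0 [u0 us]; split.
  move=> i; rewrite mxE; case: splitP => j _; last exact: u0.
  by rewrite ord1 !mxE eqxx.
rewrite big_ord_recl mxE; case: splitP => // j _.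
rewrite ord1 mxE eqxx mulr1n -lerBrDl; apply: le_trans us.
rewrite le_eqVlt; apply/orP; left; apply/eqP.
apply: eq_bigr => i _; rewrite mxE; case: splitP => k.
  by rewrite ord1.
by rewrite /= /bump => -[/val_inj ->].
Qed.

Lemma Lint_ge0 s c (p : {mpoly R[s]}) : 0 <= c ->
  (forall x, in_ref c x -> 0 <= ev p x) -> 0 <= Lint c p.
Proof.
elim: s c p => [|s IH] c p c0 h.
  rewrite -ref_int_ev //=; apply: h; split; last by rewrite big_ord0.
  by move=> i; case: i.
rewrite Lint_sectional; apply: pint_ge0 => // t t0 tc.
rewrite horner_sectional; apply: IH; first by rewrite subr_ge0.
by move=> u hu; rewrite ev_slice; apply: h; apply: in_ref_slice.
Qed.

Lemma slice_eq0 s c (p : {mpoly R[s.+1]}) : 0 < c ->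
  (forall t, 0 < t -> t < c -> slice t p = 0) -> p = 0.
Proof.
move=> c0 h.
(* [monom_lin (w k) p] is the coefficient of the monomial [k] in the later variables, as a
   polynomial in the first one. It vanishes on an interval. *)
pose w k (m : 'X_{1..s.+1}) : {poly R} := (mtail m == k)%:R *: 'X^(m ord0).
have hw k t : (monom_lin (w k) p).[t] = (slice t p)@_k.
  elim/mpoly_add_ind: p {h} => [e m|p q IHp IHq]; last first.
    by rewrite !linearD hornerD /= IHp IHq.
  rewrite !linearZ /= hornerZ sliceX mcoeffZ; congr (_ * _).
  by rewrite monom_linX hornerZ hornerXn mcoeffX mulrC.
have w0 k : monom_lin (w k) p = 0.
  by apply: (poly_eq0_itv c0) => t t0 tc; rewrite hw h // mcoeff0.
apply/mpolyP => m; rewrite mcoeff0 -[RHS](coef0 R (m ord0)) -(w0 (mtail m)).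
elim/mpoly_add_ind: p {h w0 hw} => [e m'|p q IHp IHq]; last first.
  by rewrite mcoeffD linearD coefD IHp IHq.
rewrite mcoeffZ (_ : monom_lin _ (e *: _) = e *: w (mtail m) m'); last first.
  by rewrite linearZ /= monom_linX.
rewrite !coefZ mcoeffX coefXn -natrM mulnb; congr (_ * _%:R).
congr nat_of_bool; apply/eqP/andP => [->|[/eqP e1 /eqP e0]]; first by rewrite !eqxx.
exact: mtail_inj.
Qed.

(** The section polynomial is nonnegative with zero integral, hence zero; so every interior slice
    has zero integral, and the induction hypothesis makes it vanish. *)
Lemma Lint_eq0 s c (p : {mpoly R[s]}) : 0 < c ->
  (forall x, in_ref c x -> 0 <= ev p x) -> Lint c p = 0 -> p = 0.
Proof.
elim: s c p => [|s IH] c p c0 h.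
  rewrite -ref_int_ev ?ltW //= -(mpolyKC p) ev_const => ->.
  exact: mpolyC0.
rewrite Lint_sectional => e.
have s0 : sectional c p = 0.
  apply: (pint_eq0 c0) e => t t0 tc.
  rewrite horner_sectional; apply: Lint_ge0; first by rewrite subr_ge0.
  by move=> u hu; rewrite ev_slice; apply: h; apply: in_ref_slice.
apply: (slice_eq0 c0) => t t0 tc; apply: (IH (c - t)); first by rewrite subr_gt0.
  by move=> u hu; rewrite ev_slice; apply: h; apply: in_ref_slice => //; apply: ltW.
by rewrite -horner_sectional s0 horner0.
Qed.

Lemma ev_eq0 s (p : {mpoly R[s]}) : (forall x, ev p x = 0) -> p = 0.
Proof.
move=> h; apply: (@Lint_eq0 _ 1) => //; first by move=> x _; rewrite h.
rewrite -ref_int_ev // (_ : ev p = ev 0) ?ref_int_ev ?linear0 //.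
by apply/funext => x; rewrite h ev0.
Qed.

Lemma ev_inj s (p q : {mpoly R[s]}) : (forall x, ev p x = ev q x) -> p = q.
Proof.
move=> h; apply/eqP; rewrite -subr_eq0; apply/eqP/ev_eq0 => x.
by rewrite ev_add ev_opp h subrr.
Qed.

(* The integral of p over the slanted facet of the reference simplex; it is also
   the integral of the i-th partial derivative of p whenever 'X_i divides p, and
   the independence of i makes the divergence theorem an algebraic identity. *)
Definition Lbnd s (p : {mpoly R[s]}) : R :=
  monom_lin (fun m => (mfact m)%:R / ((mdeg m + s).-1`!)%:R : R^o) p.

Lemma Lbnd_is_scalar s : scalar (@Lbnd s).
Proof. exact: monom_lin_is_linear. Qed.

HB.instance Definition _ s :=
  GRing.isLinear.Build R {mpoly R[s]} R _ (@Lbnd s) (@Lbnd_is_scalar s).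

Lemma LbndX s m : @Lbnd s 'X_[m] = (mfact m)%:R / ((mdeg m + s).-1`!)%:R.
Proof. exact: monom_linX. Qed.

Lemma Lint_mderiv s i (q : {mpoly R[s]}) :
  Lint 1 (mderiv i ('X_i * q)) = Lbnd ('X_i * q).
Proof.
elim/mpoly_add_ind: q => [e m|p q IHp IHq]; last first.
  by rewrite mulrDr !linearD /= IHp IHq.
rewrite -scalerAr !linearZ /= -mpolyXD mderivX linearZ /= LintX LbndX expr1n mulr1.
have -> : (U_(i) + m - U_(i))%MM = m by rewrite addmC addmK.
rewrite mfactU mdegD mdeg1 mnmDE mnm1E eqxx add1n addSn /=.
by rewrite natrM -[in RHS]mulrA add1n.
Qed.

(** On the slanted facet the coordinates sum to 1. For a monomial [m] in [s.+1] variables this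
    amounts to the numbers [m i + 1] adding up to [mdeg m + s + 1]. *)
Lemma Lbnd_hyp s (q : {mpoly R[s]}) : (0 < s)%N ->
  Lbnd ((1 - \sum_i 'X_i) * q) = 0.
Proof.
case: s q => // s q _.
elim/mpoly_add_ind: q => [e m|p q IHp IHq]; last first.
  by rewrite mulrDr linearD /= IHp IHq addr0.
rewrite -scalerAr linearZ /= mulrBl mul1r mulr_suml linearB /= LbndX addnS /=.
have -> : Lbnd (\sum_i 'X_i * 'X_[m]) =
    \sum_(i < s.+1) (mfact m)%:R / ((mdeg m + s).+1`!)%:R * (m i).+1%:R.
  rewrite [LHS]linear_sum; apply: eq_bigr => i _ /=.
  rewrite -mpolyXD LbndX mfactU mdegD mdeg1 add1n addnS /= natrM mulrC.
  by rewrite mulrCA mulrC [_^-1 * _]mulrC.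
rewrite -mulr_sumr -natr_sum.
have -> : (\sum_(i < s.+1) (m i).+1 = (mdeg m + s).+1)%N.
  rewrite -addnS mdegE -[X in (_ + X)%N]card_ord -sum1_card -big_split /=.
  by apply: eq_bigr => i _; rewrite addn1.
rewrite factS natrM invfM; apply/eqP; rewrite mulf_eq0; apply/orP; right.
by rewrite subr_eq0 eq_sym mulrA mulrAC mulfVK // pnatr_eq0.
Qed.

End ReferenceSimplex.

(** * Simplices and barycentric coordinates *)

Section Barycentric.
Variables (R : realType) (s : nat) (v : 'I_s.+1 -> 'rV[R]_s).
Hypothesis vK : nondegenerate_simplex v.
Local Notation E := (edges v).

Let Eunit : E \in unitmx.
Proof. by rewrite -row_free_unit. Qed.

(** The gradient of the barycentric coordinate of vertex [j], as a row vector. The columns of the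
    inverse edge matrix are dual to the edges, and the gradient for the first vertex makes all of
    them sum to zero. *)
Definition bgrad (j : 'I_s.+1) : 'rV[R]_s :=
  if unlift ord0 j is Some i then (col i (invmx E))^T
  else - \sum_i (col i (invmx E))^T.

Lemma bgrad_lift i : bgrad (lift ord0 i) = (col i (invmx E))^T.
Proof. by rewrite /bgrad liftK. Qed.

Lemma bgrad_ord0 : bgrad ord0 = - \sum_i bgrad (lift ord0 i).
Proof.
rewrite /bgrad unlift_none; congr (- _); apply: eq_bigr => i _.
by rewrite liftK.
Qed.

Lemma sum_bgrad : \sum_j bgrad j = 0.
Proof. by rewrite big_ord_recl bgrad_ord0 addNr. Qed.

Lemma edges_bgrad i j :
  (v i - v ord0) *m (bgrad j)^T = ((i == j)%:R - (ord0 == j)%:R)%:M.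
Proof.
have h i' j' : (v (lift ord0 i') - v ord0) *m (bgrad (lift ord0 j'))^T
    = ((i' == j')%:R)%:M.
  rewrite bgrad_lift trmxK (_ : v _ - _ = row i' E); last first.
    by apply/rowP => t; rewrite !mxE.
  rewrite -row_mul.
  apply/matrixP => x y; rewrite !ord1 !mxE.
  have := mulmxV Eunit => /matrixP /(_ i' j'); rewrite !mxE => <-.
  by apply: eq_bigr => t _; rewrite !mxE.
case: (unliftP ord0 i) => [i'|] ->; last by rewrite !subrr mul0mx raddf0.
case: (unliftP ord0 j) => [j'|] ->.
  by rewrite h (inj_eq (@lift_inj _ _)) /= subr0.
rewrite bgrad_ord0 raddfN /= mulmxN raddf_sum /= mulmx_sumr.
rewrite (eq_bigr (fun j' => ((i' == j')%:R)%:M)) => [|j' _]; last exact: h.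
rewrite (bigD1 i') //= eqxx big1 ?addr0 ?eqxx //=; last first.
  by move=> t ti; rewrite eq_sym (negPf ti) raddf0.
by rewrite sub0r raddfN.
Qed.

(** As the gradients sum to zero, [v j] may be replaced by [v j - v ord0]; the rest is the transpose
    of [invmx E *m E = 1]. *)
Lemma sum_vertex_bgrad : \sum_j (v j)^T *m bgrad j = 1%:M.
Proof.
rewrite big_ord_recl bgrad_ord0 mulmxN mulmx_sumr addrC -sumrB.
rewrite -[1%:M]trmx1 -(mulVmx Eunit) trmx_mul.
apply/matrixP => a b; rewrite summxE mxE; apply: eq_bigr => i _.
by rewrite bgrad_lift -mulmxBl !mxE big_ord1 !mxE.
Qed.

Definition bcoef (j : 'I_s.+1) : R := (ord0 == j)%:R - (v ord0 *m (bgrad j)^T) 0 0.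

Definition lam (j : 'I_s.+1) : {mpoly R[s]} :=
  (bcoef j)%:MP + \sum_i (bgrad j 0 i)%:MP * 'X_i.

Lemma ev_lam j x : ev (lam j) x = (ord0 == j)%:R + ((x - v ord0) *m (bgrad j)^T) 0 0.
Proof.
rewrite /lam ev_add ev_const ev_sum mulmxBl [in RHS]mxE [X in _ = _ + (_ + X)]mxE.
rewrite -addrA [X in _ = _ + X]addrC; congr (_ + (_ + _)).
by rewrite mxE; apply: eq_bigr => i _; rewrite ev_mul ev_const ev_X !mxE mulrC.
Qed.

Lemma ev_lam_shift j x y : ev (lam j) (x + y) = ev (lam j) x + (y *m (bgrad j)^T) 0 0.
Proof. by rewrite !ev_lam addrAC mulmxDl mxE addrA. Qed.

Lemma ev_lam_vertex i j : ev (lam j) (v i) = (i == j)%:R.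
Proof. by rewrite ev_lam edges_bgrad mxE eqxx mulr1n addrC subrK. Qed.

Lemma vertex_bgrad i i' j :
  ((v i - v i') *m (bgrad j)^T) 0 0 = (i == j)%:R - (i' == j)%:R.
Proof.
rewrite -(ev_lam_vertex i) -(ev_lam_vertex i').
have := ev_lam_shift j (v i') (v i - v i'); rewrite [v i' + _]addrC subrK => ->.
by rewrite addrAC subrr add0r.
Qed.

Lemma sum_lam : \sum_j lam j = 1.
Proof.
apply: ev_inj => x; rewrite ev_sum ev1.
rewrite (eq_bigr (fun j => (ord0 == j)%:R + ((x - v ord0) *m (bgrad j)^T) 0 0));
  last by move=> j _; rewrite ev_lam.
have e : \sum_j (bgrad j)^T = 0 by rewrite -[RHS]trmx0 -sum_bgrad raddf_sum.
rewrite big_split /= -summxE -mulmx_sumr e mulmx0 mxE addr0.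
by rewrite (bigD1 ord0) //= big1 ?addr0 // => j; rewrite eq_sym => /negPf ->.
Qed.

Lemma barycentric_expansion x : x = \sum_j ev (lam j) x *: v j.
Proof.
have h y : \sum_j (y *m (bgrad j)^T) 0 0 *: v j = y.
  transitivity (y *m (\sum_j (v j)^T *m bgrad j)^T); last first.
    by rewrite sum_vertex_bgrad trmx1 mulmx1.
  rewrite raddf_sum mulmx_sumr; apply: eq_bigr => j _.
  by rewrite /= trmx_mul trmxK mulmxA [y *m _]mx11_scalar mul_scalar_mx !mxE.
rewrite -[LHS](subrK (v ord0)) -{1}(h (x - v ord0)).
under [RHS]eq_bigr do rewrite ev_lam scalerDl.
rewrite big_split /= addrC; congr (_ + _).
rewrite (bigD1 ord0) //= scale1r big1 ?addr0 // => j.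
by rewrite eq_sym => /negPf ->; rewrite scale0r.
Qed.

(** The gradients span, by [sum_vertex_bgrad], so a field may be tested on its components along
    them. *)
Lemma bgrad_ext n (u : 'M[{mpoly R[s]}]_(s, n)) :
  (forall j, cstM s (bgrad j) *m u = 0) -> u = 0.
Proof.
move=> h; rewrite -[u]mul1mx -cstM1 -sum_vertex_bgrad cstM_sum mulmx_suml big1 // => j _.
by rewrite cstM_mul -mulmxA h mulmx0.
Qed.

End Barycentric.

(** * Divisibility by barycentric coordinates, positivity and the divergence theorem on a simplex *)

Section Simplex.
Variables (R : realType) (s : nat) (v : 'I_s.+1 -> 'rV[R]_s).
Hypothesis vK : nondegenerate_simplex v.
Local Notation E := (edges v).
Local Notation P := {mpoly R[s]}.
Local Notation lam := (lam v).
Local Notation bgrad := (bgrad v).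

Definition mdvd (p q : P) := exists r, q = p * r.

Lemma lam_neq0 j : lam j != 0.
Proof.
apply/eqP => h; have := ev_lam_vertex vK j j.
by rewrite h ev0 eqxx => /esym/eqP; rewrite oner_eq0.
Qed.

Lemma lam_inj_dvd i j : mdvd (lam j) (lam i) -> i = j.
Proof.
case=> r /(congr1 (fun p => ev p (v i))); rewrite ev_mul !ev_lam_vertex // eqxx.
by case: eqP => // _ /eqP; rewrite mul0r oner_eq0.
Qed.

Lemma exists_other (j : 'I_s.+1) : (0 < s)%N -> exists i, i != j.
Proof.
move=> s0; exists (if j == ord0 then ord_max else ord0).
by case: (eqVneq j ord0) => [->|]; rewrite ?[ord0 == _]eq_sym // -val_eqE /= -lt0n.
Qed.

(* the projection onto the hyperplane lam j = 0 along an edge through v j *)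
Lemma lam_projection j : (0 < s)%N -> exists pr : {rmorphism P -> P},
  (forall p, mdvd (lam j) (p - pr p)) /\
  (forall p, pr p = 0 <-> forall x, ev (lam j) x = 0 -> ev p x = 0).
Proof.
move=> s0; have [i ij] := exists_other j s0.
pose e := v j - v i.
have ge : (e *m (bgrad j)^T) 0 0 = 1.
  by rewrite vertex_bgrad // eqxx (negPf ij) subr0.
pose T := 1%:M - (bgrad j)^T *m e.
pose o := - bcoef v j *: e.
have yx x : o + x *m T = x - ev (lam j) x *: e.
  rewrite /T mulmxBr mulmx1 mulmxA [x *m _]mx11_scalar mul_scalar_mx addrCA.
  congr (_ + _); rewrite -scalerBl -scaleNr; congr (_ *: _).
  rewrite ev_lam /bcoef mulmxBl !(mxE, =^~ addrA) /=.
  rewrite -!opprD; congr (- _); rewrite -!addrA; congr (_ + _); exact: addrC.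
have l0 x : ev (lam j) (x - ev (lam j) x *: e) = 0.
  by rewrite ev_lam_shift -scaleNr -scalemxAl mxE ge mulr1 subrr.
exists (aff o T : {rmorphism P -> P}); split=> p.
  elim/mpoly_ring_ind: p => [c|t|p q [a pa] [b qb]|p q [a pa] [b qb]].
  - by exists 0; rewrite /= affC subrr mulr0.
  - exists (e 0 t)%:MP; apply: ev_inj => x.
    rewrite ev_add ev_opp /= ev_aff yx ev_mul ev_const !ev_X !mxE; ring.
  - by exists (a + b); rewrite rmorphD /= mulrDr -pa -qb opprD addrACA.
  - exists (a * q + aff o T p * b); rewrite rmorphM /= mulrDr mulrA -pa.
    by rewrite mulrCA -qb mulrBl mulrBr addrA subrK.
split=> [p0 x lx|h].
  by have := congr1 (fun p => ev p x) p0; rewrite ev0 /= ev_aff yx lx scale0r subr0.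
by apply: ev_eq0 => x; rewrite /= ev_aff yx h.
Qed.

(** [p] differs from its pullback by the projection by a multiple of [lam j], and that pullback is
    zero when [p] vanishes on the hyperplane. *)
Lemma lam_dvdP j p : (0 < s)%N ->
  mdvd (lam j) p <-> (forall x, ev (lam j) x = 0 -> ev p x = 0).
Proof.
move=> s0; have [pr [h1 h2]] := lam_projection j s0.
split=> [[r ->] x|]; first by rewrite ev_mul => ->; rewrite mul0r.
by move=> /h2 p0; have := h1 p; rewrite p0 subr0.
Qed.

(** The projection is a ring morphism into a domain. *)
Lemma lam_prime j p q : (0 < s)%N ->
  mdvd (lam j) (p * q) -> mdvd (lam j) p \/ mdvd (lam j) q.
Proof.
move=> s0; have [pr [h1 h2]] := lam_projection j s0.
rewrite !(lam_dvdP _ _ s0) -!h2 rmorphM => /eqP.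
by rewrite mulf_eq0 => /orP[]/eqP; [left|right].
Qed.

(** Distinct barycentric coordinates are primes that do not divide each other, so they can be split
    off one at a time. *)
Lemma prod_lam_dvd (J : seq 'I_s.+1) p : (0 < s)%N -> uniq J ->
  (forall j, j \in J -> mdvd (lam j) p) -> mdvd (\prod_(j <- J) lam j) p.
Proof.
move=> s0; elim: J => [|j J IH] /=.
  by move=> _ _; exists p; rewrite big_nil mul1r.
move=> /andP[jJ uJ] h.
have [q pq] : mdvd (\prod_(j <- J) lam j) p.
  by apply: IH => // i iJ; apply: h; rewrite inE iJ orbT.
have nd : ~ mdvd (lam j) (\prod_(j <- J) lam j).
  elim: {IH uJ h pq} J jJ => [|i J IH].
    have [i ij] := exists_other j s0.
    rewrite big_nil => _ [r] /(congr1 (fun p => ev p (v i))).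
    rewrite ev1 ev_mul ev_lam_vertex // (negPf ij) mul0r => /eqP.
    by rewrite oner_eq0.
  rewrite inE negb_or big_cons => /andP[ji jJ] /lam_prime -/(_ s0) [|].
    by move=> /lam_inj_dvd /eqP; rewrite eq_sym (negPf ji).
  exact: IH.
have [|//|[r qr]] := lam_prime s0 (p := \prod_(j <- J) lam j) (q := q) (j := j).
  by rewrite -pq; apply: h; rewrite inE eqxx.
by exists r; rewrite big_cons pq qr mulrCA mulrA.
Qed.

Lemma msize_lam j : (0 < s)%N -> (1 < msize (lam j))%N.
Proof.
move=> s0; have [i ij] := exists_other j s0.
rewrite ltnNge; apply/negP => /msize1_polyC e.
have := ev_lam_vertex vK i j; have := ev_lam_vertex vK j j.
by rewrite e !ev_const eqxx (negPf ij) => -> /eqP; rewrite oner_eq0.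
Qed.

Lemma msize_prod_lam (J : seq 'I_s.+1) : (0 < s)%N ->
  (size J < msize (\prod_(j <- J) lam j))%N.
Proof.
move=> s0; elim: J => [|j J IH]; first by rewrite big_nil msize1.
rewrite big_cons msizeM ?lam_neq0 //=; last first.
  by rewrite -msize_poly_eq0 -lt0n (leq_trans _ IH).
have := msize_lam j s0; case: (msize (lam j)) => // n; rewrite ltnS => n0.
by rewrite addSn /= -addn1 addnC leq_add.
Qed.

Lemma lam_quot_Pol m j p : (0 < s)%N -> Pol m.+1 (lam j * p) -> Pol m p.
Proof.
by move=> s0; rewrite -addn1; apply: Pol_factor; rewrite ?lam_neq0 ?msize_lam.
Qed.

Definition vol : R := Num.sqrt (\det (E *m E^T)).

Lemma vol_gt0 : 0 < vol.
Proof.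
rewrite /vol det_mulmx det_tr sqrtr_gt0 -expr2 exprn_even_gt0 //=.
by rewrite -unitfE -unitmxE -row_free_unit.
Qed.

Definition Iv (p : P) : R := vol * Lint 1 (aff (v ord0) E p).

Lemma aff_scalable d o T : scalable (@aff R d s o T).
Proof. by move=> c p; rewrite -!mul_mpolyC rmorphM /= affC. Qed.

Lemma Iv_is_scalar : scalar Iv.
Proof.
by move=> c p q; rewrite /Iv rmorphD /= aff_scalable linearP mulrDr mulrCA.
Qed.

HB.instance Definition _ := GRing.isLinear.Build R P R _ Iv Iv_is_scalar.

Lemma simplex_int_ev p : simplex_int v (ev p) = Iv p.
Proof.
rewrite /simplex_int /Iv -ref_int_ev //; congr (_ * ref_int _ _).
by apply/funext => t; rewrite ev_aff.
Qed.

Definition in_K x := forall j, 0 <= ev (lam j) x.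

Lemma ev_lam_lift i t : ev (lam (lift ord0 i)) (v ord0 + t *m E) = t 0 i.
Proof.
have h k : (E *m (bgrad (lift ord0 i))^T) k 0 = (k == i)%:R.
  transitivity (((v (lift ord0 k) - v ord0) *m (bgrad (lift ord0 i))^T) 0 0).
    by rewrite !mxE; apply: eq_bigr => ? _; rewrite !mxE.
  by rewrite vertex_bgrad // (inj_eq (@lift_inj _ _)) /= subr0.
rewrite ev_lam_shift ev_lam_vertex //= -mulmxA add0r.
rewrite mxE (bigD1 i) //= h eqxx mulr1 big1 ?addr0 // => k ki.
by rewrite h (negPf ki) mulr0.
Qed.

Lemma in_ref_K t : in_ref 1 t -> in_K (v ord0 + t *m E).
Proof.
move=> [t0 t1] j; case: (unliftP ord0 j) => [i|] ->; first by rewrite ev_lam_lift.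
have := congr1 (fun p => ev p (v ord0 + t *m E)) (sum_lam v).
rewrite ev1 ev_sum big_ord_recl => /(canRL (addrK _)) ->.
rewrite subr_ge0; apply: le_trans t1; rewrite le_eqVlt; apply/orP; left.
by apply/eqP; apply: eq_bigr => i _; rewrite ev_lam_lift.
Qed.

Lemma aff_eq0 p : aff (v ord0) E p = 0 -> p = 0.
Proof.
move=> h; apply: ev_eq0 => x.
have := congr1 (fun p => ev p ((x - v ord0) *m invmx E)) h.
rewrite ev0 ev_aff mulmxKV; last by rewrite -row_free_unit.
by rewrite addrC subrK.
Qed.

Lemma Iv_ge0 p : (forall x, in_K x -> 0 <= ev p x) -> 0 <= Iv p.
Proof.
move=> h; apply: mulr_ge0; first exact/ltW/vol_gt0.
by apply: Lint_ge0 => // t /in_ref_K /h; rewrite ev_aff.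
Qed.

Lemma Iv_eq0 p : (forall x, in_K x -> 0 <= ev p x) -> Iv p = 0 -> p = 0.
Proof.
move=> h /eqP; rewrite mulf_eq0 (negPf (lt0r_neq0 vol_gt0)) /= => /eqP e.
apply: aff_eq0; apply: Lint_eq0 e => // t /in_ref_K /h.
by rewrite ev_aff.
Qed.

Lemma Iv_sq_eq0 w q : w != 0 -> (forall x, in_K x -> 0 <= ev w x) ->
  Iv (w * q ^+ 2) = 0 -> q = 0.
Proof.
move=> w0 h /Iv_eq0 e; have /eqP : w * q ^+ 2 = 0.
  by apply: e => x /h h'; rewrite expr2 !ev_mul mulr_ge0 // -expr2 sqr_ge0.
by rewrite mulf_eq0 (negPf w0) expf_eq0 => /eqP.
Qed.

(** Each weighted square has a nonnegative integral, so all of them vanish. The weights used later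
    are barycentric coordinates and products of two of them. *)
Lemma Iv_sum_sq_eq0 (I : finType) (A : pred I) (w q : I -> P) :
  (forall i, A i -> w i != 0) -> (forall i x, A i -> in_K x -> 0 <= ev (w i) x) ->
  Iv (\sum_(i | A i) w i * q i ^+ 2) = 0 -> forall i, A i -> q i = 0.
Proof.
move=> w0 h; rewrite linear_sum /= => /eqP; rewrite psumr_eq0; last first.
  move=> i Ai; apply: Iv_ge0 => x xK.
  by rewrite expr2 !ev_mul mulr_ge0 ?h // -expr2 sqr_ge0.
move=> /allP e i Ai; apply: (@Iv_sq_eq0 (w i)); first exact: w0.
  by move=> x; apply: h.
by have /(_ (mem_index_enum i)) := e i; rewrite Ai /= => /eqP.
Qed.

Lemma Iv_pairing_eq0 m (p : P) : Pol m p ->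
  (forall q, Pol m q -> Iv (p * q) = 0) -> p = 0.
Proof.
move=> pm h; apply: (@Iv_sq_eq0 1); rewrite ?oner_eq0 //.
  by move=> x _; rewrite ev1 ler01.
by rewrite mul1r expr2; apply: h.
Qed.

(** Divisible by all [s + 1] barycentric coordinates, [p] is their product times a quotient of
    degree at most [k - s - 1]. Testing with this quotient gives a weighted square. *)
Lemma prod_lam_bubble k p : (0 < s)%N -> (s < k)%N -> Pol k p ->
  (forall j, mdvd (lam j) p) ->
  (forall q, Pol (k - s.+1) q -> Iv (p * q) = 0) -> p = 0.
Proof.
move=> s0 sk pk hp h.
have [q pq] : mdvd (\prod_(j <- enum 'I_s.+1) lam j) p.
  by apply: prod_lam_dvd => //; exact: enum_uniq.
have b0 : \prod_(j <- enum 'I_s.+1) lam j != 0.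
    by rewrite prodf_seq_neq0; apply/allP => j _; exact: lam_neq0.
have qk : Pol (k - s.+1) q.
  apply: (@Pol_factor _ _ _ s.+1 (\prod_(j <- enum 'I_s.+1) lam j)) => //.
    by have := msize_prod_lam (enum 'I_s.+1) s0; rewrite size_enum_ord.
  by rewrite subnK // -pq.
suff q0 : q = 0 by rewrite pq q0 mulr0.
apply: Iv_sq_eq0 b0 _ _.
  by move=> x xK; rewrite ev_prod; apply: prodr_ge0.
by rewrite expr2 mulrA -pq; apply: h.
Qed.

(** Divergence theorem without boundary term: [bgrad j] is normal to the facet [lam j = 0], so the
    hypothesis says that the normal components vanish there. *)
Lemma Iv_div (u : 'cV[P]_s) :
  (forall j, mdvd (lam j) ((cstM s (bgrad j) *m u) 0 0)) ->
  Iv (\sum_i mderiv i (u i 0)) = 0.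
Proof.
move=> hu; have [s0|s0] := posnP s.
  rewrite big1 ?linear0 // => i _.
  by have := leq_trans (ltn_ord i) (eq_leq s0); rewrite ltn0.
pose g j := (cstM s (bgrad j) *m u) 0 0.
pose al := aff (v ord0) E.
have alM p q : al (p * q) = al p * al q by exact: rmorphM.
have alS (F : 'I_s -> P) : al (\sum_i F i) = \sum_i al (F i) by exact: rmorph_sum.
have alN p : al (- p) = - al p by exact: rmorphN.
have allam i : al (lam (lift ord0 i)) = 'X_i.
  by apply: ev_inj => t; rewrite ev_aff ev_X ev_lam_lift.
have al0 : al (lam ord0) = 1 - \sum_i 'X_i.
  rewrite -(rmorph1 al) -(sum_lam v) big_ord_recl rmorphD /= rmorph_sum.
  by rewrite (eq_bigr _ (fun i _ => allam i)) addrK.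
(* Edges and gradients are dual bases, so the divergence is the sum of the edge derivatives of the
   components [g]. Edge derivatives become partial derivatives on the reference simplex. *)
have divE : \sum_i mderiv i (u i 0) =
    \sum_i \sum_j (E i j)%:MP * mderiv j (g (lift ord0 i)).
  rewrite exchange_big; apply: eq_bigr => j _ /=.
  transitivity (mderiv j (\sum_i (E i j)%:MP * g (lift ord0 i))); last first.
    by rewrite raddf_sum; apply: eq_bigr => i _ /=; rewrite mderiv_mulC.
  congr mderiv; transitivity ((cstM s (E^T *m (invmx E)^T) *m u) j 0).
    by rewrite -trmx_mul mulVmx -?row_free_unit // trmx1 cstM1 mul1mx.
  rewrite cstM_mul -mulmxA mxE; apply: eq_bigr => i _.
  rewrite [X in X * _]mxE [X in X%:MP * _]mxE /g; congr (_ * _).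
  rewrite [LHS]mxE [RHS]mxE. apply: eq_bigr => l _; rewrite !mxE.
  by rewrite bgrad_lift !mxE.
rewrite divE /Iv rmorph_sum /=.
rewrite (eq_bigr (fun i => mderiv i (al (g (lift ord0 i))))); last first.
  by move=> i _; rewrite aff_mderiv.
have step i : Lint 1 (mderiv i (al (g (lift ord0 i)))) = Lbnd (al (g (lift ord0 i))).
  have [r gr] := hu (lift ord0 i).
  by rewrite /g gr alM allam Lint_mderiv.
(* The gradients sum to zero, so the boundary terms add up to minus that of [g ord0], whose factor
   [1 - \sum_i 'X_i] is annihilated by [Lbnd]. *)
have sg : \sum_i g (lift ord0 i) = - g ord0.
  rewrite /g bgrad_ord0 cstMN cstM_sum mulNmx mulmx_suml mxE summxE opprK.
  by [].
have [r gr] := hu ord0.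
have -> : Lint 1 (\sum_i mderiv i (al (g (lift ord0 i)))) =
    Lbnd (al (\sum_i g (lift ord0 i))).
  rewrite alS [LHS]linear_sum [RHS]linear_sum.
  by apply: eq_bigr => i _; exact: step.
by rewrite sg /g gr alN alM al0 linearN /= Lbnd_hyp // oppr0 mulr0.
Qed.

End Simplex.

(** * Vector and matrix fields *)

Section VectorCalculus.
Variables (R : realType) (s : nat).
Local Notation P := {mpoly R[s]}.
Implicit Types (q : 'cV[P]_s) (n : nat).

Lemma dhomog_mderiv n i (p : P) : p \is n.+1.-homog -> mderiv i p \is n.-homog.
Proof.
move=> /dhomogP h; apply/dhomogP => m; rewrite mcoeff_msupp mcoeff_mderiv => m0.
have /h : (m + U_(i))%MM \in msupp p.
  by rewrite mcoeff_msupp; apply: contra m0 => /eqP ->; rewrite mul0rn.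
by rewrite /= mdegD mdeg1 addn1 => -[].
Qed.

Lemma dhomog_Pol n (p : P) : p \is n.-homog -> Pol n p.
Proof.
move=> /dhomogP h; apply/PolP => m; apply: contraTeq; rewrite -mcoeff_msupp.
by move=> /h /= ->; rewrite ltnn.
Qed.

Lemma euler n (p : P) : p \is n.-homog -> \sum_j mderiv j p * 'X_j = n%:R * p.
Proof.
move=> /pihomog_dE <-; elim/mpoly_add_ind: p => [c m|p q IHp IHq]; last first.
  rewrite pihomogD mulrDr -IHp -IHq -big_split; apply: eq_bigr => j _.
  by rewrite mderivD mulrDl.
rewrite linearZ /= pihomogX; case: eqP => [<-|_]; last first.
  by rewrite scaler0 mulr0 big1 // => j _; rewrite mderiv0 mul0r.
rewrite /= mdegE natr_sum mulr_suml; apply: eq_bigr => j _.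
rewrite mderivZ mderivX -!scalerAl -mpolyXD -scalerAr; congr (_ *: _).
have [->|mj] := eqVneq (m j) 0%N; first by rewrite scale0r mul0r.
by rewrite submK ?lep1mP // -mul_mpolyC mpolyC_nat.
Qed.

Definition pgrad (p : P) : 'cV[P]_s := \col_j mderiv j p.

Lemma pgradZ (c : R) p : pgrad (c%:MP * p) = c%:MP *: pgrad p.
Proof. by apply/colP => i; rewrite !mxE mderiv_mulC. Qed.

Definition xdot q : P := \sum_i 'X_i * q i 0.

Lemma xdotD q q' : xdot (q + q') = xdot q + xdot q'.
Proof. by rewrite -big_split; apply: eq_bigr => i _; rewrite mxE mulrDr. Qed.

Lemma xdotZ (p : P) q : xdot (p *: q) = p * xdot q.
Proof. by rewrite mulr_sumr; apply: eq_bigr => i _; rewrite mxE mulrCA. Qed.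

Lemma xdot_homog n q : HomM n q -> xdot q \is n.+1.-homog.
Proof.
move=> h; apply: rpred_sum => i _; rewrite -[n.+1]add1n; apply: dhomogM => //.
by rewrite dhomogX /= mdeg1.
Qed.

Lemma xdot_pgrad n (p : P) : p \is n.-homog -> xdot (pgrad p) = n%:R * p.
Proof.
move=> /euler <-; apply: eq_bigr => i _; by rewrite mxE mulrC.
Qed.

Lemma xdot_skew (B : 'M[P]_s) : B^T = - B -> xdot (B *m coords R s) = 0.
Proof.
move=> hB; have Bij i j : B j i = - B i j.
  by have /matrixP /(_ i j) := hB; rewrite !mxE.
have xB : xdot (B *m coords R s) = \sum_i \sum_j 'X_i * (B i j * 'X_j).
  by apply: eq_bigr => i _; rewrite mxE mulr_sumr; apply: eq_bigr => j _; rewrite mxE.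
have e : xdot (B *m coords R s) = - xdot (B *m coords R s).
  rewrite {1}xB exchange_big xB -sumrN; apply: eq_bigr => j _ /=.
  rewrite -sumrN; apply: eq_bigr => i _.
  by rewrite Bij mulNr mulrN mulrA mulrC mulrA mulrAC -!mulrA.
apply/eqP; move/eqP: e; rewrite -subr_eq0 opprK -mulr2n -mulr_natl mulf_eq0.
by rewrite -mpolyC_nat mpolyC_eq0 pnatr_eq0.
Qed.

Lemma grad_coords n q : HomM n q -> grad q *m coords R s = n%:R *: q.
Proof.
move=> h; apply/colP => i; rewrite !mxE -(euler (h i 0)).
by apply: eq_bigr => j _; rewrite !mxE.
Qed.

Lemma gradT_coords q : (grad q)^T *m coords R s = pgrad (xdot q) - q.
Proof.
apply/colP => j; rewrite !mxE raddf_sum /=.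
under [X in _ = X - _]eq_bigr do rewrite mderivM mderivXU.
rewrite big_split /= [X in _ = X + _ - _](bigD1 j) //= eqxx mul1r.
rewrite [X in _ = _ + X + _ - _]big1 ?addr0; last first.
  by move=> i ij; rewrite eq_sym (negPf ij) mul0r.
by rewrite [RHS]addrC addKr; apply: eq_bigr => i _; rewrite !mxE mulrC.
Qed.

Lemma gradD q q' : grad (q + q') = grad q + grad q'.
Proof. by apply/matrixP => i j; rewrite !mxE mderivD. Qed.

Lemma gradZ (c : R) q : grad (c%:MP *: q) = c%:MP *: grad q.
Proof. by apply/matrixP => i j; rewrite !mxE mderiv_mulC. Qed.

Lemma sym_gradD q q' : sym_grad (q + q') = sym_grad q + sym_grad q'.
Proof. by rewrite /sym_grad gradD [(_ + _)^T]linearD /= addrACA scalerDr. Qed.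

Lemma sym_gradZ (c : R) q : sym_grad (c%:MP *: q) = c%:MP *: sym_grad q.
Proof. by rewrite /sym_grad gradZ [(_ *: _)^T]linearZ /= -scalerDr scalerA mulrC -scalerA. Qed.

Lemma sym_grad0 : sym_grad (0 : 'cV[P]_s) = 0.
Proof. by rewrite -{1}(scale0r 0) -(mpolyC0 s R) sym_gradZ mpolyC0 scale0r. Qed.

Lemma sym_grad_tr q : (sym_grad q)^T = sym_grad q.
Proof. by rewrite /sym_grad [LHS]linearZ /= [(_ + _)^T]linearD /= trmxK addrC. Qed.

Lemma PolM_sym_grad n q : PolM n.+1 q -> PolM n (sym_grad q).
Proof.
move=> h i j; rewrite !mxE; apply: Pol_CM; apply: PolD; apply: Pol_mderiv; exact: h.
Qed.

(** Euler's identity handles [grad q]; the product rule for [q.x] handles its transpose. *)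
Lemma sym_grad_coords n q : HomM n q ->
  2%:R *: (sym_grad q *m coords R s) = (n%:R - 1) *: q + pgrad (xdot q).
Proof.
move=> h; rewrite /sym_grad -scalemxAl scalerA -mpolyC_nat -mpolyCM.
rewrite mulfV ?pnatr_eq0 // scale1r mulmxDl (grad_coords h) gradT_coords.
by rewrite scalerBl scale1r addrA addrAC.
Qed.

Lemma Pol_sub_pihomog n (p : P) : Pol n.+1 p -> Pol n (p - pihomog mdeg n.+1 p).
Proof.
move=> /PolP h; apply/PolP => m nm.
have e : (pihomog mdeg n.+1 p)@_m = if mdeg m == n.+1 then p@_m else 0.
  elim/mpoly_add_ind: {h} p => [c m'|p q IHp IHq]; last first.
    by rewrite pihomogD !mcoeffD IHp IHq; case: ifP => //; rewrite addr0.
  rewrite linearZ /= pihomogX !mcoeffZ mcoeffX.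
  have [<-|ne] := eqVneq m' m.
    by case: ifP; rewrite ?mcoeffX ?eqxx ?mcoeff0 ?mulr0.
  rewrite mulr0 if_same; case: ifP => _; last by rewrite mcoeff0 mulr0.
  by rewrite mcoeffX (negPf ne) mulr0.
rewrite mcoeffB e; case: eqP => [_|ne]; first by rewrite subrr.
by rewrite subr0 h // ltn_neqAle eq_sym nm andbT; apply/eqP.
Qed.

Lemma ND_PolM n q : PolM n q -> ND n q.
Proof.
move=> h; exists q, 0; split; rewrite ?mul0mx ?addr0 ?trmx0 ?oppr0 //.
by move=> i j; rewrite mxE dhomog0.
Qed.

(* The top degree part h of q satisfies
   (n + 2) h = grad (h.x) + (grad h - (grad h)^T) x. *)
Lemma ND_pgrad_decomp n q : PolM n.+1 q ->
  exists q0 p, [/\ ND n q0, p \is n.+2.-homog & q = q0 + pgrad p].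
Proof.
move=> hq; pose h : 'cV[P]_s := map_mx (pihomog mdeg n.+1) q.
have hh : HomM n.+1 h by move=> i j; rewrite mxE; apply: pihomogP.
pose c : R := n.+2%:R^-1.
have c1 : c%:MP * n.+2%:R = 1 :> P.
  by rewrite -mpolyC_nat -mpolyCM mulVf ?pnatr_eq0.
exists ((q - h) + (c%:MP *: (grad h - (grad h)^T)) *m coords R s), (c%:MP * xdot h).
split.
- exists (q - h), (c%:MP *: (grad h - (grad h)^T)); split=> //.
  + by move=> i j; rewrite !mxE; apply: Pol_sub_pihomog.
  + move=> i j; rewrite !mxE mul_mpolyC; apply: dhomogZ.
    by apply: rpredB; apply: dhomog_mderiv; apply: pihomogP.
  + by rewrite linearZ /= linearB /= trmxK -scalerN opprB.
- rewrite mul_mpolyC; apply: dhomogZ; exact: xdot_homog.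
- rewrite pgradZ -scalemxAl mulmxBl (grad_coords hh) gradT_coords -addrA -scalerDr.
  have -> : n.+1%:R *: h - (pgrad (xdot h) - h) + pgrad (xdot h) = n.+2%:R *: h.
    by rewrite opprB addrA subrK -[X in _ + X]scale1r -scalerDl natr1.
  by rewrite scalerA c1 scale1r subrK.
Qed.

Lemma scale2I (a b : 'cV[P]_s) : 2%:R *: a = 2%:R *: b -> a = b.
Proof.
move=> /(congr1 (fun x => (2%:R^-1 : R)%:MP *: x)).
by rewrite !scalerA -mpolyC_nat -mpolyCM mulVf ?pnatr_eq0 // !scale1r.
Qed.

(** Hence symmetric fields are sums of some [def q] and a field annihilating [x]. The equation
    [def(q) x = tau x] is solved explicitly for each homogeneous part. *)
Lemma sym_grad_coords_surj n (sigma : 'M[P]_s) : PolSym n sigma ->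
  exists2 q, PolM n.+1 q & sym_grad q *m coords R s = sigma *m coords R s.
Proof.
have hsurj m (tau : 'M[P]_s) : HomM m tau -> tau^T = tau ->
    exists2 q, HomM m.+1 q & sym_grad q *m coords R s = tau *m coords R s.
  move=> hm ts; pose w := tau *m coords R s.
  have hw : HomM m.+1 w.
    move=> i j; rewrite mxE; apply: rpred_sum => l _; rewrite mxE -[m.+1]addn1.
    by apply: dhomogM => //; rewrite dhomogX /= mdeg1.
  (* For constant [tau] the factor [n - 1] in [sym_grad_coords] is zero, but [q = tau x] has
     gradient [tau]. *)
  case: m hm hw => [|m] hm hw.
    exists w => //.
    suff e : grad w = tau by rewrite /sym_grad e ts -mulr2n -[tau *+ 2]scaler_nat
      scalerA -mpolyC_nat -mpolyCM mulVf ?pnatr_eq0 // scale1r.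
    apply/matrixP => i j; rewrite !mxE raddf_sum (bigD1 j) //= big1 ?addr0.
      have := dhomog_Pol (hm i j) => /msize1_polyC ->.
      by rewrite mderiv_mulC mxE mderivXU eqxx mulr1.
    move=> l lj; have := dhomog_Pol (hm i l) => /msize1_polyC ->.
    by rewrite mderiv_mulC mxE mderivXU eq_sym (negPf lj) mulr0.
  (* Ansatz [q = a (w - b grad(w.x))]. By [sym_grad_coords] in degree [m + 2], the choice
     [(m + 1) a = 2] gives [2 w - 2 b grad(w.x) + grad(q.x)], and [b] is such that the gradients
     cancel. *)
  pose k : R := m.+2%:R; pose b : R := (2%:R * k)^-1; pose a : R := 2%:R / m.+1%:R.
  pose q := a%:MP *: (w - b%:MP *: pgrad (xdot w)).
  have hq : HomM m.+2 q.
    move=> i j; rewrite !mxE mul_mpolyC; apply: dhomogZ; apply: rpredB.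
      by have := hw i j; rewrite mxE.
    rewrite mul_mpolyC; apply: dhomogZ; apply: dhomog_mderiv; exact: xdot_homog.
  exists q => //; apply: scale2I.
  rewrite (sym_grad_coords hq).
  have xq : xdot q = (k^-1)%:MP * xdot w.
    rewrite xdotZ xdotD -scaleNr xdotZ (xdot_pgrad (xdot_homog hw)).
    rewrite -{1}[xdot w]mul1r mulrA -mulrDl mulrA; congr (_ * _).
    rewrite -mpolyC1 -mpolyC_nat -mpolyCN -mpolyCM -mpolyCD -mpolyCM; congr (_%:MP).
    rewrite /a /b /k; field.
    by rewrite !(natr1, =^~ natrD, nat1r) !pnatr_eq0.
  rewrite xq pgradZ /q scalerA -!mpolyC_nat -mpolyC1 -mpolyCB -mpolyCM.
  have -> : (m.+2%:R - 1) * a = 2%:R.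
    rewrite -natr1 addrK /a mulrCA mulfV ?mulr1 // pnatr_eq0 //.
  rewrite scalerBr scalerA -mpolyCM (_ : 2%:R * b = k^-1) ?subrK //.
  by rewrite /b invfM mulrA mulfV ?mul1r // pnatr_eq0.
move=> [hp hs].
have /boolp.choice [f hf] : forall j : 'I_n.+1, exists q : 'cV[P]_s, HomM j.+1 q /\
    sym_grad q *m coords R s = map_mx (pihomog mdeg j) sigma *m coords R s.
  move=> j; have [||q q1 q2] := hsurj j (map_mx (pihomog mdeg j) sigma).
  - by move=> a b; rewrite mxE; apply: pihomogP.
  - by rewrite map_trmx hs.
  - by exists q.
exists (\sum_j f j).
  move=> a b; rewrite summxE; apply: Pol_sum => j _.
  by apply: Pol_le (dhomog_Pol ((hf j).1 a b)); rewrite ltnS -ltnS.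
have -> : sigma = \sum_(j < n.+1) map_mx (pihomog mdeg j) sigma.
  apply/matrixP => a b; rewrite summxE {1}(pihomog_partitionE (hp a b)).
  by apply: eq_bigr => j _; rewrite mxE.
rewrite mulmx_suml (big_morph _ sym_gradD sym_grad0) mulmx_suml.
by apply: eq_bigr => j _; exact: (hf j).2.
Qed.

End VectorCalculus.

(** * Green's formulas and uniqueness for fields with vanishing normal components *)

Section Interior.
Variables (R : realType) (s : nat) (v : 'I_s.+1 -> 'rV[R]_s).
Hypothesis vK : nondegenerate_simplex v.
Local Notation P := {mpoly R[s]}.
Local Notation lam := (lam v).
Local Notation bgrad := (bgrad v).
Local Notation Iv := (Iv v).

Definition vec_div (u : 'cV[P]_s) : P := \sum_i mderiv i (u i 0).

Lemma mxtrace_trmul_colE (u q : 'cV[P]_s) : \tr (u^T *m q) = \sum_i u i 0 * q i 0.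
Proof.
by rewrite /mxtrace big_ord1 mxE; apply: eq_bigr => i _; rewrite mxE.
Qed.

Lemma mxtrace_trmulE m n (A B : 'M[P]_(m, n)) : \tr (A^T *m B) = \sum_j \sum_i A i j * B i j.
Proof.
apply: eq_bigr => j _; rewrite mxE; apply: eq_bigr => i _; by rewrite mxE.
Qed.

Lemma green (u : 'cV[P]_s) p :
  (forall j, mdvd (lam j) ((cstM s (bgrad j) *m u) 0 0)) ->
  Iv (\tr (u^T *m pgrad p)) = - Iv (vec_div u * p).
Proof.
move=> hu; apply/eqP; rewrite -addr_eq0 -linearD /=; apply/eqP.
rewrite (_ : _ + _ = \sum_i mderiv i ((p *: u) i 0)).
  apply: Iv_div => // j; rewrite -scalemxAr mxE.
  by have [r ->] := hu j; exists (p * r); rewrite mulrCA.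
rewrite mxtrace_trmul_colE mulr_suml -big_split; apply: eq_bigr => i _ /=.
by rewrite !mxE mderivM mulrC [X in _ + X]mulrC.
Qed.

(** A symmetric [tau] pairs equally with [grad q] and its transpose, and [tau q] inherits the
    vanishing normal components. *)
Lemma green_sym (tau : 'M[P]_s) q : tau^T = tau ->
  (forall j i, mdvd (lam j) ((cstM s (bgrad j) *m tau) 0 i)) ->
  Iv (\tr (tau^T *m sym_grad q)) = - Iv (\tr ((row_div tau)^T *m q)).
Proof.
move=> ts ht; apply/eqP; rewrite -addr_eq0 -linearD /=; apply/eqP.
have tij i j : tau j i = tau i j.
  by have /matrixP /(_ i j) := ts; rewrite mxE.
rewrite (_ : _ + _ = \sum_i mderiv i ((tau *m q) i 0)).
  apply: Iv_div => // j; rewrite mulmxA mxE.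
  have /boolp.choice [r hr] := ht j.
  exists (\sum_i r i * q i 0); rewrite mulr_sumr; apply: eq_bigr => i _.
  by rewrite hr mulrA.
have -> : \tr (tau^T *m sym_grad q) = \tr (tau^T *m grad q).
  have e : \tr (tau^T *m (grad q)^T) = \tr (tau^T *m grad q).
    by rewrite -mxtrace_tr trmx_mul !trmxK mxtrace_mulC ts.
  rewrite /sym_grad -scalemxAr mxtraceZ mulmxDr mxtraceD e -mulr2n.
  rewrite -[X in _ * X = _]mulr_natl mulrA.
  by rewrite -mpolyC_nat -mpolyCM mulVf ?pnatr_eq0 // mpolyC1 mul1r.
rewrite mxtrace_trmulE mxtrace_trmul_colE.
rewrite [X in _ + X](eq_bigr (fun i => \sum_j mderiv j (tau i j) * q i 0));
  last by move=> i _; rewrite mxE mulr_suml.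
rewrite [X in _ + X]exchange_big -big_split; apply: eq_bigr => j _ /=.
rewrite mxE raddf_sum -big_split; apply: eq_bigr => i _ /=.
by rewrite mderivM !mxE addrC [tau j i]tij.
Qed.

(** Used twice: for the tangential part of [tau n] on a facet, and for [div tau] on the whole
    simplex. *)
Lemma bdm_unisolvent n (u : 'cV[P]_s) : (0 < s)%N -> PolM n.+2 u ->
  (forall j, mdvd (lam j) ((cstM s (bgrad j) *m u) 0 0)) ->
  (forall q, ND n q -> Iv (\tr (u^T *m q)) = 0) -> u = 0.
Proof.
move=> s0 un hu hq.
(* div u is orthogonal to itself, because gradients of degree n lie in ND n *)
have div0 : vec_div u = 0.
  apply: (@Iv_pairing_eq0 _ _ _ vK n.+1).
    by apply: Pol_sum => i _; apply: Pol_mderiv; apply: un.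
  move=> p pn; apply/eqP; rewrite -oppr_eq0 -green //; apply/eqP/hq/ND_PolM.
  by move=> i j; rewrite mxE; apply: Pol_mderiv.
(* Gradients are now orthogonal to [u], and together with [ND n] they contain all polynomial fields
   of degree [n + 1]. *)
have all0 q : PolM n.+1 q -> Iv (\tr (u^T *m q)) = 0.
  move=> /ND_pgrad_decomp [q0 [p [/hq h0 _ ->]]].
  by rewrite mulmxDr mxtraceD linearD /= h0 green // div0 mul0r linear0 oppr0 addr0.
have /boolp.choice [phi hphi] := hu.
have phin j : Pol n.+1 (phi j).
  apply: (lam_quot_Pol vK s0 (j := j)); rewrite -hphi mxE.
  by apply: Pol_sum => i _; rewrite mxE; apply: Pol_CM; apply: un.
(* Testing with [\sum_j phi j * grad (lam j)] gives the integral of [\sum_j lam j * phi j ^ 2]. *)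
have phi0 : forall j, true -> phi j = 0.
  apply: (@Iv_sum_sq_eq0 _ _ _ vK _ xpredT lam) => [j _|j x _ xK|].
  - exact: lam_neq0.
  - exact: xK.
  rewrite -[RHS](all0 (\sum_j phi j *: (cstM s (bgrad j))^T)); last first.
    move=> a b; rewrite summxE; apply: Pol_sum => j _.
    rewrite !mxE mulrC; exact: Pol_CM.
  congr Iv; rewrite mulmx_sumr raddf_sum; apply: eq_bigr => j _ /=.
  rewrite -scalemxAr mxtraceZ -trmx_mul mxtrace_tr /mxtrace big_ord1 hphi.
  by rewrite expr2 mulrA mulrC.
apply: (bgrad_ext vK) => j; apply/matrixP => a b; rewrite !ord1 hphi phi0 // mulr0.
by rewrite mxE.
Qed.

(** An off-diagonal component [t i j] along two gradients is divisible by [lam i] and, by symmetry,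
    by [lam j]. The quotients form a test field that makes the pairing a weighted sum of squares. *)
Lemma sym_bubble n (tau : 'M[P]_s) : (0 < s)%N -> PolM n.+2 tau -> tau^T = tau ->
  (forall j i, mdvd (lam j) ((cstM s (bgrad j) *m tau) 0 i)) ->
  (forall sigma, PolSym n sigma -> Iv (\tr (tau^T *m sigma)) = 0) -> tau = 0.
Proof.
move=> s0 tn ts ht h.
pose t i j := (cstM s (bgrad i) *m tau *m cstM s (bgrad j)^T) 0 0.
have tC i j : t i j = t j i.
  rewrite /t -[in LHS](trmxK (_ *m _ *m _)) mxE !trmx_mul ts mulmxA.
  by rewrite -!cstM_tr trmxK.
have tdvd i j : mdvd (lam i) (t i j).
  have /boolp.choice [r hr] := ht i.
  exists (\sum_l r l * (cstM s (bgrad j)^T) l 0).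
  rewrite /t mxE mulr_sumr; apply: eq_bigr => l _.
  by rewrite hr mulrA.
have tn' i j : Pol n.+2 (t i j).
  rewrite /t mxE; apply: Pol_sum => l _; rewrite mulrC mxE; apply: Pol_CM.
  by rewrite mxE; apply: Pol_sum => l' _; rewrite mxE; apply: Pol_CM; exact: tn.
(* Setting [phi] to 0 on the diagonal lets the test field [sigma] run over all pairs. *)
have /boolp.choice [phi hphi] : forall ij : 'I_s.+1 * 'I_s.+1, exists r,
    if ij.1 == ij.2 then r = 0 else t ij.1 ij.2 = lam ij.1 * lam ij.2 * r.
  move=> [i j] /=; case: eqVneq => [|ij]; first by exists 0.
  have [r] : mdvd (\prod_(l <- [:: i; j]) lam l) (t i j).
    apply: prod_lam_dvd => //=; first by rewrite inE ij.
    by move=> l; rewrite !inE => /orP[] /eqP -> //; rewrite tC.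
  by rewrite !big_cons big_nil mulr1 => ->; exists r.
have phiC i j : phi (i, j) = phi (j, i).
  have := hphi (i, j); have := hphi (j, i) => /=; rewrite eq_sym.
  case: eqP => [_ -> -> //|_]; rewrite tC => -> /eqP.
  rewrite [lam j * _]mulrC -subr_eq0 -mulrBr mulf_eq0 mulf_eq0.
  by rewrite !(negPf (lam_neq0 vK _)) /= subr_eq0 => /eqP.
have phin ij : Pol n (phi ij).
  have := hphi ij; case: eqP => [_ ->|_ e]; first exact: Pol0.
  apply: (lam_quot_Pol vK s0 (j := ij.2)); apply: (lam_quot_Pol vK s0 (j := ij.1)).
  by rewrite mulrA -e.
pose sigma : 'M[P]_s :=
  \sum_ij phi ij *: ((cstM s (bgrad ij.1))^T *m cstM s (bgrad ij.2)).
have sn : PolSym n sigma.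
  split.
    move=> a b; rewrite summxE; apply: Pol_sum => ij _.
    rewrite !mxE big_ord1 !mxE -mpolyCM mulrC; exact: Pol_CM.
  rewrite /sigma raddf_sum /=.
  rewrite (reindex_inj (h := fun ij : 'I_s.+1 * 'I_s.+1 => (ij.2, ij.1))) /=; last first.
    by move=> [a b] [c d] [-> ->].
  apply: eq_bigr => -[i j] _ /=; rewrite linearZ /= trmx_mul trmxK phiC //.
have phi0 : forall ij : 'I_s.+1 * 'I_s.+1, ij.1 != ij.2 -> phi ij = 0.
  apply: (@Iv_sum_sq_eq0 _ _ _ vK _ _ (fun ij => lam ij.1 * lam ij.2))
    => [j _|j x _ xK|].
  - by rewrite mulf_neq0 ?lam_neq0.
  - by rewrite ev_mul mulr_ge0 ?xK.
  rewrite -[RHS](h sigma) //; congr Iv.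
  rewrite mulmx_sumr raddf_sum big_mkcond; apply: eq_bigr => -[i j] _ /=.
  have := hphi (i, j) => /=; case: eqVneq => [_ ->|ij e] /=.
    by rewrite scale0r mulmx0 mxtrace0.
  rewrite -scalemxAr mxtraceZ mulmxA mxtrace_mulC ts.
  rewrite /mxtrace big_ord1 mulmxA -cstM_tr -/(t j i) tC e.
  by rewrite expr2 mulrA mulrC.
have t0 i j : i != j -> t i j = 0.
  move=> ij; have := hphi (i, j); rewrite /= (negPf ij) => ->.
  by rewrite phi0 // mulr0.
(* The gradients sum to zero, so a diagonal component is minus the sum of the off-diagonal ones in
   its row. *)
have tii i : t i i = 0.
  have : \sum_j t i j = 0.
    rewrite /t -summxE -mulmx_sumr -cstM_sum.
    have -> : \sum_j (bgrad j)^T = 0 by rewrite -[RHS]trmx0 -(sum_bgrad v) raddf_sum.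
    by rewrite cstM0 mulmx0 mxE.
  rewrite (bigD1 i) //= big1 ?addr0 // => j; rewrite eq_sym; exact: t0.
apply: (bgrad_ext vK) => i; apply: trmx_inj; rewrite trmx0.
apply: (bgrad_ext vK) => j; apply/matrixP => a b; rewrite !ord1 [RHS]mxE.
transitivity (t j i); last by have [->|] := eqVneq j i; [exact: tii | exact: t0].
by rewrite /t trmx_mul ts -cstM_tr mulmxA.
Qed.

Lemma interior_unisolvent n (tau : 'M[P]_s) : (0 < s)%N ->
  PolM n.+3 tau -> tau^T = tau ->
  (forall j i, mdvd (lam j) ((cstM s (bgrad j) *m tau) 0 i)) ->
  (forall j, mdvd (lam j) ((cstM s (bgrad j) *m row_div tau) 0 0)) ->
  (forall q, ND n q -> Iv (\tr (tau^T *m sym_grad q)) = 0) ->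
  (forall sigma, ker_x_PolSym n.+1 sigma -> Iv (\tr (tau^T *m sigma)) = 0) ->
  tau = 0.
Proof.
move=> s0 tn ts ht hd hdef hker.
have div0 : row_div tau = 0.
  apply: (@bdm_unisolvent n) => //.
    by move=> a b; rewrite mxE; apply: Pol_sum => i _; apply: Pol_mderiv; exact: tn.
  by move=> q nq; apply/eqP; rewrite -oppr_eq0 -green_sym //; apply/eqP/hdef.
apply: (@sym_bubble n.+1) => // sigma hsig.
have [q qn qx] := sym_grad_coords_surj hsig.
(* This [q] has degree [n + 2] and need not lie in [ND n]: its symmetric gradient is handled by
   [div tau = 0], the remainder by the kernel moments. *)
have -> : sigma = sym_grad q + (sigma - sym_grad q) by rewrite addrC subrK.
rewrite mulmxDr mxtraceD linearD /= green_sym // div0 trmx0 mul0mx mxtrace0.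
rewrite linear0 oppr0 add0r; apply: hker; split; last first.
  by rewrite mulmxBl qx subrr.
split; last by rewrite linearB /= sym_grad_tr hsig.2.
move=> a b; rewrite [X in Pol _ X]mxE [X in _ + X]mxE; apply: PolB; first exact: hsig.1.
exact: PolM_sym_grad.
Qed.

End Interior.

(** * Dimensions *)

Section Dimension.
Variables (R : realType) (s : nat).
Local Notation P := {mpoly R[s]}.
Implicit Types (V W : lmodType P).

(** Linearity over the reals: the spaces are modules over polynomials, on which real scalars act as
    constants. *)
Definition rlinear V W (f : V -> W) :=
  forall (a : R) x y, f (a%:MP *: x + y) = a%:MP *: f x + f y.

(** Injective parametrization by row vectors, which makes matrix rank available for dimensions. *)
Definition rcoord n V (f : 'rV[R]_n -> V) :=
  (forall (a : R) x y, f (a *: x + y) = a%:MP *: f x + f y) /\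
  (forall x, f x = 0 -> x = 0).

Lemma rcoord0 n V (f : 'rV[R]_n -> V) : rcoord f -> f 0 = 0.
Proof.
by move=> [h _]; have := h (-1) 0 0; rewrite scaler0 addr0 mpolyCN scaleN1r addNr.
Qed.

Lemma rcoordE n V (f : 'rV[R]_n -> V) x : rcoord f ->
  f x = \sum_i (x 0 i)%:MP *: f (delta_mx 0 i).
Proof.
move=> fc; have [h _] := fc; rewrite {1}(row_sum_delta x).
elim/big_rec2: _ => [|i y z _ <-]; first exact: rcoord0.
by rewrite h.
Qed.

Lemma has_dimP V (S : V -> Prop) n :
  has_dim S n <->
  exists2 f : 'rV[R]_n -> V, rcoord f & forall v, S v <-> exists c, v = f c.
Proof.
split=> [[b [bi bs]]|[f fc fs]].
  exists (fun c => \sum_i (c 0 i)%:MP *: b i).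
    split=> [a x y|x /bi h].
      rewrite scaler_sumr -big_split; apply: eq_bigr => i _ /=.
      by rewrite !mxE mpolyCD mpolyCM scalerDl scalerA.
    by apply/rowP => i; rewrite h mxE.
  move=> w; rewrite bs; split=> [[c ->]|[c ->]].
    by exists (\row_i c i); apply: eq_bigr => i _; rewrite mxE.
  by exists (fun i => c 0 i).
exists (fun i => f (delta_mx 0 i)); split.
  move=> c h i; have := fc.2 (\row_i c i); rewrite (rcoordE _ fc).
  under eq_bigr do rewrite mxE.
  by move=> /(_ h) /rowP /(_ i); rewrite !mxE.
move=> w; rewrite fs; split=> [[c ->]|[c ->]].
  by exists (fun i => c 0 i); exact: rcoordE.
exists (\row_i c i); rewrite (rcoordE _ fc); apply: eq_bigr => i _.
by rewrite mxE.
Qed.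

Lemma has_dim_ext V (S S' : V -> Prop) n :
  (forall v, S v <-> S' v) -> has_dim S n -> has_dim S' n.
Proof.
move=> e [b [b1 b2]]; exists b; split=> // w; rewrite -e; exact: b2.
Qed.

Lemma has_dim_le V (S S' : V -> Prop) n m :
  (forall v, S v -> S' v) -> has_dim S n -> has_dim S' m -> (n <= m)%N.
Proof.
move=> sub /has_dimP[f fc fs] /has_dimP[g gc gs].
have /boolp.choice [A hA] : forall i, exists c, f (delta_mx 0 i) = g c.
  by move=> i; apply/gs/sub/fs; exists (delta_mx 0 i).
pose M : 'M_(n, m) := \matrix_i A i.
have fM x : f x = g (x *m M).
  rewrite (rcoordE _ fc) mulmx_sum_row.
  have gsum (r : seq 'I_n) :
      g (\sum_(i <- r) x 0 i *: row i M) = \sum_(i <- r) (x 0 i)%:MP *: g (row i M).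
    elim: r => [|i r IH]; first by rewrite !big_nil (rcoord0 gc).
    by rewrite !big_cons gc.1 IH.
  by rewrite gsum; apply: eq_bigr => i _; rewrite rowK hA.
have : row_free M.
  apply/inj_row_free => x xM; apply: fc.2; rewrite fM xM; exact: rcoord0.
by rewrite /row_free => /eqP <-; exact: rank_leq_col.
Qed.

Lemma has_dim_uniq V (S : V -> Prop) n m : has_dim S n -> has_dim S m -> n = m.
Proof. by move=> h h'; apply/eqP; rewrite eqn_leq !(has_dim_le _ h h', has_dim_le _ h' h). Qed.

Lemma polydimE V (S : V -> Prop) n : has_dim S n -> polydim S = n.
Proof.
move=> h; apply: xget_unique => // m /has_dim_uniq; exact.
Qed.

(** Among the row spaces contained in [U] one has largest rank; it is all of [U], since a vector of
    [U] outside it could be adjoined. *)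
Lemma subspace_mx n (U : 'rV[R]_n -> Prop) : U 0 ->
  (forall a x y, U x -> U y -> U (a *: x + y)) ->
  exists M : 'M[R]_n, forall x, U x <-> (x <= M)%MS.
Proof.
move=> U0 UD.
pose A r := `[< exists2 M : 'M[R]_n, (forall x, (x <= M)%MS -> U x) & \rank M = r >].
have exA : exists r, A r.
  exists 0%N; apply/asboolP; exists 0; last exact: mxrank0.
  by move=> x; rewrite submx0 => /eqP ->.
have ubA r : A r -> (r <= n)%N by move=> /asboolP[M _ <-]; exact: rank_leq_row.
case: (ex_maxnP exA ubA) => r /asboolP[M MU rM] rmax.
exists M => x; split=> [Ux|]; last exact: MU.
apply/negPn/negP => xM.
have : A (\rank (M + x)%MS).
  apply/asboolP; exists (M + x)%MS => // y /sub_addsmxP [[u w] ->] /=.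
  rewrite -[u *m M]scale1r; apply: (UD _ _ _); first by apply: MU; exact: submxMl.
  have /sub_rVP [a ->] := submxMl w x.
  by rewrite -[_ *: _]addr0; apply: (UD _ _ _).
move=> /rmax; apply/negP; rewrite -ltnNge -rM; apply: rank_ltmx.
by rewrite /ltmx addsmxSl addsmx_sub submx_refl.
Qed.

(** In coordinates the kernel is the row space of a matrix [M]; [f] is injective on a complement,
    which parametrizes the image. *)
Lemma rank_nullity V W (f : V -> W) (S : V -> Prop) n : rlinear f -> has_dim S n ->
  exists2 k, (k <= n)%N & has_dim (fun v => S v /\ f v = 0) k /\
    has_dim (fun w => exists2 v, S v & w = f v) (n - k).
Proof.
move=> fl /has_dimP[g gc gs].
have f0 : f 0 = 0 by have := fl (-1) 0 0; rewrite scaler0 addr0 mpolyCN scaleN1r addNr.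
have [|a x y h1 h2|M MP] := @subspace_mx n (fun c => f (g c) = 0).
- by rewrite rcoord0.
- by rewrite gc.1 fl h1 h2 scaler0 addr0.
have comp m (B : 'M_(m, n)) : row_free B -> rcoord (fun c => g (c *m B)).
  move=> Bf; split=> [a x y|x /gc.2 e].
    by rewrite mulmxDl -scalemxAl gc.1.
  by apply: (row_free_inj Bf); rewrite e mul0mx.
exists (\rank M); first exact: rank_leq_row.
split; apply/has_dimP.
  exists (fun c => g (c *m row_base M)); first exact: comp (row_base_free _).
  move=> w; split=> [[/gs [c ->] /MP cM]|[c ->]].
    have : (c <= row_base M)%MS by rewrite eq_row_base.
    by move=> /submxP [D ->]; exists D.
  split; first by apply/gs; eexists.
  have : (c *m row_base M <= row_base M)%MS by exact: submxMl.
  by rewrite eq_row_base => /MP.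
rewrite -mxrank_compl; exists (fun c => f (g (c *m row_base (M^C)%MS))).
  have [h1 h2] := comp _ _ (row_base_free (M^C)%MS).
  split=> [a x y|x /MP e]; first by rewrite h1 fl.
  apply: (row_free_inj (row_base_free (M^C)%MS)); rewrite mul0mx.
  apply/eqP; rewrite -submx0 -(capmx_compl M) sub_capmx e /=.
  have : (x *m row_base M^C <= row_base M^C)%MS by exact: submxMl.
  by rewrite eq_row_base.
move=> w; split=> [[x /gs [c ->] ->]|[c ->]]; last first.
  by eexists; last by []; apply/gs; eexists.
have : (c <= M + M^C)%MS by apply: submx_full; exact: addsmx_compl_full.
move=> /sub_addsmxP [[a b] /= ->].
have : (b *m M^C <= row_base M^C)%MS by rewrite eq_row_base submxMl.
move=> /submxP [D ->]; exists D.
rewrite -[a *m M]scale1r gc.1 fl.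
have -> : f (g (a *m M)) = 0 by apply/MP; exact: submxMl.
by rewrite scaler0 add0r.
Qed.

Lemma has_dim_fin V (S : V -> Prop) (J : finType) (b : J -> V) :
  (forall c : J -> R, \sum_j (c j)%:MP *: b j = 0 -> forall j, c j = 0) ->
  (forall v, S v <-> exists c : J -> R, v = \sum_j (c j)%:MP *: b j) ->
  has_dim S #|J|.
Proof.
move=> bi bs; exists (fun i => b (enum_val i)).
have e (c : 'I_#|J| -> R) : \sum_i (c i)%:MP *: b (enum_val i) =
    \sum_j (c (enum_rank j))%:MP *: b j.
  rewrite (reindex enum_rank) /=; last by apply: onW_bij; exact: enum_rank_bij.
  by apply: eq_bigr => j _; rewrite enum_rankK.
split=> [c|w].
  by rewrite e => /bi h i; rewrite -(enum_valK i).
rewrite bs; split=> [[c ->]|[c ->]].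
  exists (fun i => c (enum_val i)); rewrite e; apply: eq_bigr => j _.
  by rewrite enum_rankK.
by exists (fun j => c (enum_rank j)); rewrite e.
Qed.

End Dimension.

(** * Monomial bases of scalar, vector and symmetric matrix polynomials *)

Section PolynomialDimensions.
Variables (R : realType) (s : nat).
Local Notation P := {mpoly R[s]}.

(** Exponent vectors of degree at most [k] are tuples over ['I_k.+1] with sum at most [k], which
    [card_partial_ord_partitions] counts. *)
Lemma card_bmultinom k : #|{: 'X_{1..s < k.+1}}| = 'C(s + k, s).
Proof.
rewrite -card_partial_ord_partitions.
pose f (m : 'X_{1..s < k.+1}) : s.-tuple 'I_k.+1 := [tuple inord (m i) | i < s].
have mk (m : 'X_{1..s < k.+1}) i : (m i < k.+1)%N.
  apply: leq_ltn_trans (bmdeg m); rewrite mdegE (bigD1 i) //= leq_addr //.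
have fE m i : tnth (f m) i = m i :> nat by rewrite tnth_mktuple inordK.
have finj : injective f.
  move=> m m' e; apply/val_inj/mnmP => i /=.
  by rewrite -!fE e.
rewrite -(card_imset _ finj); apply: eq_card => t; rewrite inE.
have sumE : (\sum_(i <- t) i = \sum_i tnth t i)%N by rewrite big_tuple.
apply/imsetP/idP => [[m _ tm]|tk].
  rewrite sumE -ltnS; apply: leq_trans (bmdeg m).
  by rewrite ltnS mdegE tm; apply: leq_sum => i _; rewrite fE.
have mt : (mdeg [multinom (tnth t i : nat) | i < s] < k.+1)%N.
  rewrite ltnS mdegE; apply: leq_trans tk; rewrite sumE.
  by apply: leq_sum => i _; rewrite mnmE.
exists (BMultinom mt) => //; apply: eq_from_tnth => i; apply/val_inj.
by rewrite /= fE /= mnmE.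
Qed.

Lemma mcoeff_sum_bm k (c : 'X_{1..s < k} -> R) (j : 'X_{1..s < k}) :
  (\sum_i (c i)%:MP * 'X_[i])@_j = c j.
Proof.
rewrite raddf_sum (bigD1 j) //= mul_mpolyC mcoeffZ mcoeffX eqxx mulr1.
rewrite big1 ?addr0 // => i ij.
by rewrite mul_mpolyC mcoeffZ mcoeffX val_eqE (negPf ij) mulr0.
Qed.

Lemma Pol_expand k (p : P) : Pol k p ->
  p = \sum_(m : 'X_{1..s < k.+1}) (p@_m)%:MP * 'X_[m].
Proof.
move=> h; rewrite {1}(mpolywE h); apply: eq_bigr => m _.
by rewrite mul_mpolyC.
Qed.

Lemma Pol_bm k (c : 'X_{1..s < k.+1} -> R) : Pol k (\sum_m (c m)%:MP * 'X_[m] : P).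
Proof.
apply: Pol_sum => m _; apply: Pol_CM; apply: Pol_le (Pol_X _ _).
by rewrite -ltnS bmdeg.
Qed.

Lemma has_dim_Pol k : has_dim (@Pol R s k) 'C(s + k, s).
Proof.
rewrite -card_bmultinom.
apply: (@has_dim_fin _ _ _ _ _ (fun m : 'X_{1..s < k.+1} => 'X_[m] : P^o)).
  by move=> c h j; rewrite -(mcoeff_sum_bm c j) [X in X@__]h mcoeff0.
move=> p; split=> [/Pol_expand h|[c ->]]; last exact: Pol_bm.
by exists (fun m : 'X_{1..s < k.+1} => (p : P)@_m).
Qed.

Lemma sum_pair (I J : finType) (F : I * J -> P) :
  \sum_p F p = \sum_i \sum_j F (i, j).
Proof. by rewrite pair_bigA; apply: eq_bigr => -[]. Qed.

Lemma has_dim_PolM_col k : has_dim (@PolM R s s 1 k) (s * 'C(s + k, s)).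
Proof.
rewrite -card_bmultinom -[X in (X * _)%N](card_ord s) -card_prod.
pose b (im : 'I_s * 'X_{1..s < k.+1}) : 'cV[P]_s := 'X_[im.2] *: delta_mx im.1 0.
have bE c : \sum_im (c im)%:MP *: b im = \col_i \sum_m (c (i, m))%:MP * 'X_[m].
  apply/colP => i; rewrite summxE mxE.
  rewrite sum_pair (bigD1 i) //= [X in _ + X]big1 ?addr0; last first.
    move=> j ji; rewrite big1 // => m _.
    by rewrite !mxE eq_sym (negPf ji) /= !mulr0.
  by apply: eq_bigr => m _; rewrite !mxE !eqxx mulr1.
apply: (has_dim_fin (b := b)).
  move=> c; rewrite bE => h [i m].
  have /colP /(_ i) := h; rewrite !mxE => e.
  by rewrite -(mcoeff_sum_bm (fun m => c (i, m)) m) e mcoeff0.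
move=> q; split=> [h|[c ->]].
  exists (fun im : 'I_s * 'X_{1..s < k.+1} => (q im.1 0)@_im.2); rewrite bE.
  apply/colP => i; rewrite mxE; exact: Pol_expand.
by rewrite bE => i j; rewrite mxE; apply: Pol_bm.
Qed.

Definition le_pair := {ij : 'I_s * 'I_s | (ij.1 <= ij.2)%N}.

Lemma card_le_pair : #|{: le_pair}| = (s * s.+1)./2.
Proof.
rewrite card_sub -sum1_card.
rewrite (eq_bigl (fun ij : 'I_s * 'I_s => true && (ij.1 <= ij.2)%N)) //.
rewrite -(pair_big_dep xpredT (fun i j : 'I_s => (i <= j)%N) (fun _ _ => 1%N)) /=.
rewrite (exchange_big_dep xpredT) //=.
transitivity (\sum_(j < s) j.+1)%N.
  apply: eq_bigr => j _; rewrite -[in RHS](card_ord j.+1) -sum1_card.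
  by rewrite [RHS](big_ord_widen s (fun _ => 1%N)).
have : (\sum_(j < s) j.+1 = \sum_(0 <= i < s.+1) i)%N.
  by rewrite big_nat_recl // big_mkord add0n.
by move=> ->; rewrite bin2_sum bin2 mulnC.
Qed.

Lemma has_dim_PolSym k :
  has_dim (@PolSym R s k) ((s * s.+1)./2 * 'C(s + k, s)).
Proof.
rewrite -card_bmultinom -card_le_pair -card_prod.
(* [D] gives the elementary symmetric matrices, and [srt i j] is the index of the one with entry 1
   at [(i, j)]. *)
pose D (i j : 'I_s) : 'M[P]_s :=
  if i == j then delta_mx i i else delta_mx i j + delta_mx j i.
pose srt (i j : 'I_s) := if (i <= j)%N then (i, j) else (j, i).
have srtP i j : ((srt i j).1 <= (srt i j).2)%N.
  by rewrite /srt; case: (leqP i j) => /= [|/ltnW].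
pose sp i j : le_pair := exist _ (srt i j) (srtP i j).
pose b (im : le_pair * 'X_{1..s < k.+1}) : 'M[P]_s :=
  'X_[im.2] *: D (val im.1).1 (val im.1).2.
have DE (p : le_pair) i j : D (val p).1 (val p).2 i j = (p == sp i j)%:R.
  case: p => -[a c] /= ac; rewrite -val_eqE /= /D /srt.
  case: (eqVneq a c) ac => [->|ne] ac.
    rewrite mxE; case: (leqP i j) => ij; rewrite xpair_eqE; first by rewrite eq_sym [j == _]eq_sym.
    by rewrite eq_sym [j == _]eq_sym andbC.
  rewrite !mxE ![_ == a]eq_sym ![_ == c]eq_sym.
  case: (leqP i j) => ij; rewrite xpair_eqE.
    rewrite [X in _ + X](_ : _ = 0) ?addr0 //.
    case: (eqVneq a j) => [aj|]; last by rewrite andbF.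
    case: (eqVneq c i) => [ci|] //; move: ac ne; rewrite aj ci => ji /eqP.
    by case; apply/val_inj/eqP; rewrite eqn_leq ij ji.
  rewrite [X in X + _](_ : _ = 0) ?add0r 1?andbC //.
  case: (eqVneq a i) => [ai|] //; case: (eqVneq c j) => [cj|] //.
  by move: ac; rewrite ai cj leqNgt ij.
have bE c i j : (\sum_im (c im)%:MP *: b im) i j = \sum_m (c (sp i j, m))%:MP * 'X_[m].
  rewrite summxE sum_pair (bigD1 (sp i j)) //= [X in _ + X]big1 ?addr0; last first.
    move=> p pij; rewrite big1 // => m _.
    by rewrite !(mxE, DE) (negPf pij) !mulr0.
  by apply: eq_bigr => m _; rewrite !(mxE, DE) eqxx mulr1.
apply: (has_dim_fin (b := b)).
  move=> c h [[[i j] ij] m].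
  have /matrixP /(_ i j) := h; rewrite bE mxE => e.
  have <- : sp i j = exist _ (i, j) ij by apply/val_inj; rewrite /= /srt ij.
  by rewrite -(mcoeff_sum_bm (fun m => c (sp i j, m)) m) e mcoeff0.
have spC i j : sp i j = sp j i.
  apply/val_inj; rewrite /= /srt; case: (ltngtP i j) => // /val_inj -> //.
move=> q; split=> [[h qs]|[c ->]]; last first.
  split; first by move=> i j; rewrite bE; apply: Pol_bm.
  by apply/matrixP => i j; rewrite mxE !bE spC.
exists (fun im : le_pair * 'X_{1..s < k.+1} => (q (val im.1).1 (val im.1).2)@_im.2).
apply/matrixP => i j; rewrite bE /= /srt {1}(Pol_expand (h i j)).
apply: eq_bigr => m _; case: (leqP i j) => // _.
by have /matrixP /(_ i j) := qs; rewrite mxE => ->.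
Qed.

End PolynomialDimensions.

(** * Dimensions of [ND] and of the two interior families *)

Section FieldDimensions.
Variables (R : realType) (s : nat).
Local Notation P := {mpoly R[s]}.

Lemma pihomog_Pol n m (p : P) : (n < m)%N -> Pol n p -> pihomog mdeg m p = 0.
Proof.
move=> nm /PolP h; rewrite pihomogE big1 // => mm /eqP dm.
by rewrite h ?scale0r // (_ : mdeg mm = m).
Qed.

Lemma sum_homog_eq0 m n N (g : nat -> 'M[P]_(m, n)) : (forall j, HomM j (g j)) ->
  \sum_(j < N) g j = 0 -> forall j, (j < N)%N -> g j = 0.
Proof.
move=> hg e j jN; apply/matrixP => a b.
have := congr1 (fun M : 'M_(m, n) => pihomog mdeg j (M a b)) e.
rewrite summxE raddf_sum (bigD1 (Ordinal jN)) //= big1 ?addr0.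
  by rewrite pihomog_dE ?mxE ?pihomog0 //; exact: hg.
move=> i ij; apply: pihomog_ne0 (hg i a b); by rewrite -val_eqE in ij.
Qed.

(** Taking the part of degree [n + 1] has kernel [P_n] on [P_(n+1)]. The additive form of the count
    avoids truncated subtraction. *)
Lemma has_dim_homog n : exists2 N, has_dim (fun p : P^o => (p : P) \is n.+1.-homog) N &
  (N + 'C(s + n, s) = 'C(s + n.+1, s))%N.
Proof.
have fl : rlinear (fun p : P^o => pihomog mdeg n.+1 (p : P) : P^o).
  move=> a x y; rewrite linearD /=; congr (_ + _).
  by rewrite /GRing.scale /= !mul_mpolyC linearZ.
have [k kn [h1 h2]] := rank_nullity fl (has_dim_Pol R s n.+1).
have kE : k = 'C(s + n, s).
  apply: has_dim_uniq h1 _; apply: has_dim_ext (has_dim_Pol R s n) => p.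
  split=> [h|[hp e]].
    by split; [exact: Pol_le h | exact: pihomog_Pol h].
  by have := Pol_sub_pihomog hp; rewrite e subr0.
exists ('C(s + n.+1, s) - k)%N; last by rewrite -kE subnK.
apply: has_dim_ext h2 => p; split=> [[q _ ->]|h]; first exact: pihomogP.
by exists p; [exact: dhomog_Pol | rewrite pihomog_dE].
Qed.

(** For the converse, [q] is a member of [ND n] plus the gradient of a homogeneous [p] of degree
    [n + 2], and the part of [q.x] in that degree is [(n + 2) p]. *)
Lemma NDP n (q : 'cV[P]_s) :
  ND n q <-> PolM n.+1 q /\ pihomog mdeg n.+2 (xdot q) = 0.
Proof.
have dir (q' : 'cV[P]_s) : ND n q' -> PolM n.+1 q' /\ pihomog mdeg n.+2 (xdot q') = 0.
  move=> [p [B [hp hB Bs ->]]]; split.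
    move=> i j; rewrite mxE; apply: PolD; first by apply: Pol_le (hp i j).
    rewrite mxE; apply: Pol_sum => l _; rewrite mxE -[n.+1]addn1; apply: Pol_mul.
      exact: dhomog_Pol.
    exact: Pol_XU.
  apply: (pihomog_Pol (ltnSn n.+1)); rewrite xdotD xdot_skew // addr0.
  apply: Pol_sum => i _; rewrite -[n.+1]add1n; apply: Pol_mul; first exact: Pol_XU.
  exact: hp.
split=> [/dir //|[hq h0]].
have [q0 [p [nd0 hp qE]]] := ND_pgrad_decomp hq.
suff p0 : p = 0.
  rewrite qE p0 (_ : pgrad 0 = 0) ?addr0 //.
  by apply/colP => i; rewrite !mxE mderiv0.
have := h0; rewrite qE xdotD linearD /= (dir _ nd0).2 add0r (xdot_pgrad hp).
rewrite -mpolyC_nat mul_mpolyC linearZ /= pihomog_dE // => /eqP.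
by rewrite -mul_mpolyC mulf_eq0 mpolyC_eq0 pnatr_eq0 => /eqP.
Qed.

(** Rank and nullity for the map in [NDP], which is onto because [grad p / (n + 2)] is a preimage of
    a homogeneous [p]. *)
Lemma has_dim_ND n : exists2 N, has_dim (@ND R s n) N &
  (N + 'C(s + n.+2, s) = s * 'C(s + n.+1, s) + 'C(s + n.+1, s))%N.
Proof.
have fl : rlinear (fun q : 'cV[P]_s => pihomog mdeg n.+2 (xdot q) : P^o).
  move=> a x y; rewrite xdotD xdotZ linearD /=; congr (_ + _).
  by rewrite /GRing.scale /= !mul_mpolyC linearZ.
have [k kn [h1 h2]] := rank_nullity fl (has_dim_PolM_col R s n.+1).
have [N hN NE] := has_dim_homog n.+1.
exists k; first by apply: has_dim_ext h1 => q; rewrite NDP.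
suff e : (s * 'C(s + n.+1, s) - k)%N = N by rewrite -NE -e addnA subnKC.
apply: has_dim_uniq h2 _; apply: has_dim_ext hN => p.
split=> [hp|[q _ ->]]; last exact: pihomogP.
exists ((n.+2%:R^-1 : R)%:MP *: pgrad p).
  move=> i j; rewrite !mxE; apply: Pol_CM; apply: Pol_mderiv; exact: dhomog_Pol.
rewrite xdotZ (xdot_pgrad hp) mulrA -mpolyC_nat -mpolyCM mulVf ?pnatr_eq0 //.
by rewrite mul1r pihomog_dE.
Qed.

Lemma rlinear_sym_grad : rlinear (@sym_grad R s).
Proof. by move=> a x y; rewrite sym_gradD sym_gradZ. Qed.

Lemma rlinear_sym_grad_coords : rlinear (fun q => @sym_grad R s q *m coords R s).
Proof. by move=> a x y; rewrite rlinear_sym_grad mulmxDl scalemxAl. Qed.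

Lemma sym_grad_coords_homog n (q : 'cV[P]_s) : HomM n q ->
  HomM n (sym_grad q *m coords R s).
Proof.
move=> h.
have -> : sym_grad q *m coords R s =
    (2%:R^-1 : R)%:MP *: ((n%:R - 1) *: q + pgrad (xdot q)).
  rewrite -(sym_grad_coords h) scalerA -mpolyC_nat -mpolyCM.
  by rewrite mulVf ?pnatr_eq0 // scale1r.
move=> i j; rewrite !mxE mul_mpolyC; apply: dhomogZ; apply: dhomogD.
  rewrite -mpolyC_nat -mpolyC1 -mpolyCB mul_mpolyC; apply: dhomogZ; exact: h.
by apply: dhomog_mderiv; exact: xdot_homog.
Qed.

Lemma mx_coords_eq0 (B : 'M[P]_s) : HomM 0 B -> B *m coords R s = 0 -> B = 0.
Proof.
move=> hB /colP h; apply/matrixP => i j.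
have := congr1 (mderiv j) (h i); rewrite mxE raddf_sum (bigD1 j) //= big1 ?addr0.
  have := dhomog_Pol (hB i j) => /msize1_polyC ->.
  by rewrite !mxE mderiv_mulC mderivXU eqxx mulr1 mderiv0.
move=> l lj; have := dhomog_Pol (hB i l) => /msize1_polyC ->.
by rewrite mxE mderiv_mulC mderivXU eq_sym (negPf lj) mulr0.
Qed.

Lemma const_scale_eq0 m n (a : R) (q : 'M[P]_(m, n)) : a != 0 -> a%:MP *: q = 0 -> q = 0.
Proof.
move=> a0 /(congr1 (fun x => (a^-1)%:MP *: x)); rewrite scaler0 scalerA -mpolyCM.
by rewrite mulVf // scale1r.
Qed.

(* Both sides say that q is a rigid motion; these have degree at most 1, hence
   lie in every ND n. *)
Lemma sym_grad_coords_ker n (q : 'cV[P]_s) : PolM n.+2 q ->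
  sym_grad q *m coords R s = 0 <-> ND n q /\ sym_grad q = 0.
Proof.
move=> hq; split=> [e|[_ ->]]; last exact: mul0mx.
pose qh j : 'cV[P]_s := map_mx (pihomog mdeg j) q.
have hom j : HomM j (qh j) by move=> a b; rewrite mxE; exact: pihomogP.
have qE : q = \sum_(j < n.+3) qh j.
  apply/matrixP => a b; rewrite summxE {1}(pihomog_partitionE (hq a b)).
  by apply: eq_bigr => j _; rewrite mxE.
have e0 j : (j < n.+3)%N -> sym_grad (qh j) *m coords R s = 0.
  apply: (@sum_homog_eq0 _ _ _ (fun j => sym_grad (qh j) *m coords R s)).
    by move=> i; exact: sym_grad_coords_homog.
  by move: e; rewrite {1}qE (big_morph _ (@sym_gradD R s) (@sym_grad0 R s)) mulmx_suml.
have e1 j : (j < n.+3)%N -> (j%:R - 1) *: qh j + pgrad (xdot (qh j)) = 0.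
  by move=> jn; rewrite -(sym_grad_coords (hom j)) e0 // scaler0.
(* Taking the product of [e1] with [x] gives [2 j (q_j.x) = 0]; then [e1] itself leaves
   [(j - 1) q_j = 0]. *)
have x0 j : (0 < j < n.+3)%N -> xdot (qh j) = 0.
  move=> /andP[j0 jn]; have := congr1 (@xdot R s) (e1 j jn).
  rewrite xdotD xdotZ (xdot_pgrad (xdot_homog (hom j))) -mulrDl -natr1 addrA addrAC.
  rewrite addrNK -natrD /xdot [RHS]big1 => [|i _]; last by rewrite mxE mulr0.
  move=> /eqP; rewrite mulf_eq0 -mpolyC_nat mpolyC_eq0 pnatr_eq0 addn_eq0.
  by rewrite (gtn_eqF j0) => /eqP.
have q2 j : (1 < j < n.+3)%N -> qh j = 0.
  move=> /andP[j1 jn]; have := e1 j jn; rewrite x0 ?jn ?andbT ?(ltnW j1) //.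
  rewrite (_ : pgrad 0 = 0) ?addr0; last by apply/colP => i; rewrite !mxE mderiv0.
  case: j j1 {jn} => // j j1; rewrite -natr1 addrK -mpolyC_nat.
  by apply: const_scale_eq0; rewrite pnatr_eq0 -lt0n.
have q01 : q = qh 0%N + qh 1%N.
  rewrite {1}qE 2!big_ord_recl /= big1 => [|i _].
    by rewrite addr0.
  by apply: q2; rewrite /bump !add1n /= !ltnS; case: i.
have g0 : sym_grad (qh 0%N) = 0.
  rewrite /sym_grad (_ : grad _ = 0) ?trmx0 ?addr0 ?scaler0 //.
  apply/matrixP => a b; rewrite !mxE.
  have := dhomog_Pol (hom 0%N a 0); rewrite mxE => /msize1_polyC ->.
  by rewrite mderivC.
have g1 : sym_grad (qh 1%N) = 0.
  apply: mx_coords_eq0; last exact: e0.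
  move=> a b; rewrite !mxE mul_mpolyC; apply: dhomogZ.
  by apply: dhomogD; apply: dhomog_mderiv; exact: pihomogP.
split; last by rewrite q01 sym_gradD g0 g1 addr0.
apply/NDP; split.
  move=> a b; rewrite q01 mxE; apply: PolD.
    by apply: Pol_le (dhomog_Pol (hom 0%N a b)).
  by apply: Pol_le (dhomog_Pol (hom 1%N a b)).
apply: (@pihomog_Pol 1) => //.
rewrite q01 xdotD (x0 1%N) // addr0; apply: dhomog_Pol; exact: xdot_homog.
Qed.

(* The rigid motions are the kernel of def on ND n and of q |-> def(q) x on
   polynomials of degree n + 2, so their dimension cancels in the sum N2 + N3. *)
Lemma has_dim_interior n : exists N1 N2 N3,
  [/\ has_dim (@ND R s n) N1, has_dim (@defND R s n) N2,
      has_dim (@ker_x_PolSym R s n.+1) N3 &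
  (N2 + N3 + s * 'C(s + n.+2, s) = N1 + (s * s.+1)./2 * 'C(s + n.+1, s))%N].
Proof.
have [N1 h1 _] := has_dim_ND n.
have [k kN1 [hk h2]] := rank_nullity rlinear_sym_grad h1.
have [k' kD [hk' hi]] := rank_nullity rlinear_sym_grad_coords (has_dim_PolM_col R s n.+2).
have kk' : k' = k.
  apply: has_dim_uniq hk' _; apply: has_dim_ext hk => q.
  split=> [[hq e]|[hq e]]; last by apply/sym_grad_coords_ker.
  have hq' : PolM n.+2 q.
    by have [h _] := (NDP n q).1 hq => i j; apply: Pol_le (h i j).
  by split=> //; apply/(sym_grad_coords_ker hq').
have lx : rlinear (fun tau : 'M[P]_s => tau *m coords R s).
  by move=> a x y; rewrite mulmxDl scalemxAl.
have [k3 k3S [h3 hi']] := rank_nullity lx (has_dim_PolSym R s n.+1).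
(* The fields [def(q) x] with [q] of degree [n + 2] and [tau x] with symmetric [tau] of degree
   [n + 1] form the same space. *)
have ki : ((s * s.+1)./2 * 'C(s + n.+1, s) - k3 = s * 'C(s + n.+2, s) - k')%N.
  apply: has_dim_uniq hi' _; apply: has_dim_ext hi => w.
  split=> [[q hq ->]|[tau ht ->]].
    exists (sym_grad q) => //; split; last exact: sym_grad_tr.
    exact: PolM_sym_grad.
  by have [q hq <-] := sym_grad_coords_surj ht; exists q.
exists N1, (N1 - k)%N, k3; split=> //.
have := subnK k3S; rewrite ki kk' => <-; move: kN1 kD; rewrite kk'.
move: (s * 'C(s + n.+2, s))%N => D kN1 kD; clear -kN1 kD; lia.
Qed.

End FieldDimensions.

(** * Counting the degrees of freedom *)

Section Count.
Variable R : realType.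

Lemma card_faces d r : (r <= d)%N -> #|faces d r| = 'C(d.+1, r).
Proof.
move=> rd; rewrite /faces card_draws card_ord -subSn // bin_sub //.
exact: leqW.
Qed.

(** Absorption [(r + 1) C(d+3, r+1) = (d + 3) C(d+2, r)], then [r + 2] is split into [r] and 2 and
    the first part absorbed again. Doubling clears the half, and the factor [0 < r] covers the
    truncated [r.-1]. *)
Lemma triangle_bin d r : ((r.+1 * r.+2)./2 * 'C(d.+3, r.+1) * 2 =
  d.+3 * (d.+2 * 'C(d.+1, r.-1) * (0 < r) + 2 * 'C(d.+2, r)))%N.
Proof.
have e2 : (((r.+1 * r.+2)./2) * 2 = r.+1 * r.+2)%N.
  by rewrite muln2 -[RHS]odd_double_half oddM /= negbK andNb add0n.
rewrite mulnAC e2 mulnAC -mul_bin_diag -mulnA; congr (_ * _)%N.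
case: r {e2} => [|r] /=; first by rewrite muln0 mulnC.
rewrite muln1 mul_bin_diag; lia.
Qed.

(** With [d = e + 2], [triangle_bin] splits each summand into two products of binomials, and both
    sums are Vandermonde convolutions. *)
Lemma count_boundary e k : (0 < k)%N ->
  (e.+3 * (e.+2 * e.+3)./2 +
   \sum_(1 <= r < e.+2) 'C(e.+3, r) * ((r * r.+1)./2 * 'C(k.-1, e.+2 - r)) =
  (e.+2 * e.+3)./2 * 'C(e + k, e) + e.+3 * 'C(e.+1 + k, e.+1))%N.
Proof.
case: k => // k _ /=.
(* The vertex values supply the missing term [r = d] of the sum. *)
have -> : (e.+3 * (e.+2 * e.+3)./2 =
    'C(e.+3, e.+2) * ((e.+2 * e.+3)./2 * 'C(k, e.+2 - e.+2)))%N.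
  by rewrite subnn bin0 muln1 -bin_sub // subSnn bin1.
rewrite addnC -big_nat_recr //= big_add1 /= big_mkord.
apply/eqP; rewrite -(eqn_pmul2r (isT : 0 < 2)%N); apply/eqP.
rewrite big_distrl /=.
transitivity (\sum_(i < e.+2) (e.+3 * e.+2 * ('C(e.+1, i.-1) * (0 < i) * 'C(k, e.+1 - i))
   + e.+3 * 2 * ('C(e.+2, i) * 'C(k, e.+1 - i))))%N.
  apply: eq_bigr => i _; rewrite subSS.
  have := triangle_bin e i; set A := (_ ./2); set B := 'C(e.+3, _).
  set C := 'C(k, _); move=> h.
  transitivity (A * B * 2 * C)%N; first by rewrite mulnA [(B * A)%N]mulnC mulnAC.
  rewrite h; ring.
rewrite big_split /= -!big_distrr /= mulnDl; congr (_ + _)%N; last first.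
  by rewrite binomial.Vandermonde -[(e.+1 + k.+1)%N]addSnnS mulnAC.
rewrite big_ord_recl /= muln0 mul0n add0n.
rewrite (eq_bigr (fun i : 'I_e.+1 => 'C(e.+1, i) * 'C(k, e - i))%N); last first.
  by move=> i _; rewrite /= /bump add1n muln1 subSS.
rewrite binomial.Vandermonde -[(e + k.+1)%N]addSnnS [RHS]mulnAC; congr (_ * _)%N.
by rewrite muln2 mulnC -[LHS]odd_double_half oddM /= negbK andbN.
Qed.

Lemma has_dim_PolSym_ndofs d k : (2 <= d)%N -> (maxn d 3 <= k)%N ->
  has_dim (@PolSym R d k) (ndofs R d k).
Proof.
case: d => [|[|e]] // _; rewrite geq_max => /andP[dk k3].
suff -> : ndofs R e.+2 k = ((e.+2 * e.+3)./2 * 'C(e.+2 + k, e.+2))%N.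
  exact: has_dim_PolSym.
have k1 : (0 < k)%N by apply: leq_trans k3.
rewrite /ndofs.
(* Dimension [d - r] plus degree [k + r - d - 1] is [k - 1] for every [r]; the subtraction is exact
   since [k >= d] and [r >= 1]. *)
have -> : \sum_(1 <= r < e.+2) #|faces e.+2 r| *
      ((r * r.+1)./2 * polydim (@Pol R (e.+2 - r) (k + r - e.+3)))%N =
    \sum_(1 <= r < e.+2) 'C(e.+3, r) * ((r * r.+1)./2 * 'C(k.-1, e.+2 - r))%N.
  rewrite big_nat [RHS]big_nat; apply: eq_bigr => r /andP[r0 re].
  rewrite card_faces; last exact: ltnW.
  by rewrite (polydimE (has_dim_Pol _ _ _)); congr (_ * (_ * 'C(_, _)))%N; lia.
have [D DE] : exists D, D = ((e.+2 * e.+3)./2)%N by eexists.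
have D2 : (D * 2 = e.+2 * e.+3)%N.
  by rewrite DE muln2 -[RHS]odd_double_half oddM /= negbK andbN.
rewrite count_boundary // -DE card_faces // bin1 subn1 /=.
rewrite (polydimE (has_dim_Pol _ _ _)).
case: k k3 dk k1 => [|[|[|n]]] // _ en _; rewrite !subSS !subn0 /=.
have [N hN NE] := has_dim_ND R e.+1 n.+1.
have [N1 [N2 [N3 [h1 h2 h3 E]]]] := has_dim_interior R e.+2 n.
have [N1' h1' E1] := has_dim_ND R e.+2 n.
rewrite (has_dim_uniq h1 h1') in E.
rewrite (polydimE hN) (polydimE h2) (polydimE h3).
rewrite -DE in E; move: NE E E1 {DE hN h1 h2 h3 h1'}.
have -> : (e.+1 + n.+3 = (e + n.+3).+1)%N by lia.
have -> : (e.+1 + n.+2 = e + n.+3)%N by lia.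
have -> : (e.+2 + n.+3 = (e + n.+3).+2)%N by lia.
have -> : (e.+2 + n.+2 = (e + n.+3).+1)%N by lia.
have -> : (e.+2 + n.+1 = e + n.+3)%N by lia.
(* Pascal's rule expresses all counts through three binomials with upper index [e + n + 3]. The
   products with the number [e + 3] of facets and with [y] are supplied, so the rest is linear. *)
rewrite !binS; move: 'C(_, e.+2) 'C(_, e.+1) 'C(_, e) => x y z NE E E1.
have := congr1 (muln e.+3) NE; have := congr1 (muln^~ y) D2.
clear -E E1; lia.
Qed.

End Count.

(** * Faces and unisolvence *)

Section Frame.
Variables (R : realType) (d s : nat) (v : 'I_s.+1 -> 'rV[R]_d).
Variables (o : 'rV[R]_d) (T : 'M[R]_(s, d)).
Hypothesis vK : nondegenerate_simplex v.
Hypothesis vT : cartesian_frame v o T.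

(** The face as a full-dimensional simplex in its own Cartesian coordinates, to which the results on
    simplices apply. *)
Definition flat (i : 'I_s.+1) : 'rV[R]_s := cart_coord o T (v i).

Lemma frame_ortho : T *m T^T = 1%:M.
Proof. by case: vT. Qed.

Lemma frame_proj m (A : 'M_(m, d)) : (A <= T)%MS -> A *m T^T *m T = A.
Proof. by move=> /submxP [D ->]; rewrite -[D *m T *m _]mulmxA frame_ortho mulmx1. Qed.

Lemma edges_sub : (edges v <= T)%MS.
Proof. by case: vT => _ /andP[]. Qed.

Lemma vertex_sub i : (v i - o <= T)%MS.
Proof.
have [_ _ h0] := vT; apply: submx_trans edges_sub.
rewrite -opprB eqmx_opp -[o - v i](subrKA (v ord0)) addmx_sub //.
case: (unliftP ord0 i) => [j|] ->; last by rewrite subrr sub0mx.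
rewrite -opprB eqmx_opp.
by rewrite (_ : _ - _ = row j (edges v)) ?row_sub // rowK.
Qed.

Lemma flatE i : v i = o + flat i *m T.
Proof. by rewrite /flat /cart_coord frame_proj ?vertex_sub // addrC subrK. Qed.

Lemma flatB i j : flat i - flat j = (v i - v j) *m T^T.
Proof. by rewrite /flat /cart_coord -mulmxBl opprB addrA subrK. Qed.

Lemma edges_flat : edges flat = edges v *m T^T.
Proof.
by apply/row_matrixP => i; rewrite row_mul !rowK flatB.
Qed.

Lemma edgesE : edges v = edges flat *m T.
Proof. by rewrite edges_flat frame_proj // edges_sub. Qed.

Lemma flat_nondegenerate : nondegenerate_simplex flat.
Proof.
apply: inj_row_free => x h; apply: (row_free_inj vK).
by rewrite edgesE mulmxA h !mul0mx.
Qed.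

(** The frame is orthonormal, so the Gram matrix of the edges is unchanged. *)
Lemma simplex_int_flat f :
  simplex_int v f = simplex_int flat (fun y => f (o + y *m T)).
Proof.
rewrite /simplex_int.
have -> : edges v *m (edges v)^T = edges flat *m (edges flat)^T.
  by rewrite edgesE trmx_mul mulmxA -[_ *m T *m _]mulmxA frame_ortho mulmx1.
congr (_ * ref_int _ _); apply/funext => t.
by rewrite {1}flatE edgesE mulmxDl mulmxA addrA.
Qed.

Lemma cart_coordK y : cart_coord o T (o + y *m T) = y.
Proof. by rewrite /cart_coord addrC addKr -mulmxA frame_ortho mulmx1. Qed.

Lemma ip_flat (p : {mpoly R[d]}) (q : {mpoly R[s]}) :
  ip v (ev p) (fun x => ev q (cart_coord o T x)) = Iv flat (aff o T p * q).
Proof.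
rewrite /ip simplex_int_flat -simplex_int_ev; congr simplex_int.
by apply/funext => y; rewrite cart_coordK ev_mul ev_aff.
Qed.

Lemma ipM_flat (u : 'cV[{mpoly R[d]}]_d) (q : 'cV[{mpoly R[s]}]_s) :
  ipM v (evM u) (fun x => T^T *m evM q (cart_coord o T x)) =
  Iv flat (\tr ((map_mx (aff o T) (cstM d T *m u))^T *m q)).
Proof.
rewrite /ipM simplex_int_flat -simplex_int_ev; congr simplex_int.
apply/funext => y; rewrite cart_coordK ev_tr evM_mul evM_tr; congr (\tr _).
rewrite mulmxA; congr (_ *m _); rewrite -trmx_mul; congr (_^T).
transitivity (evM (cstM d T *m u) (o + y *m T)); first by rewrite evM_mul evM_cst.
by apply/matrixP => i j; rewrite !mxE ev_aff.
Qed.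

Lemma flat_barycentric y : o + y *m T = \sum_i ev (lam flat i) y *: v i.
Proof.
under eq_bigr do rewrite flatE scalerDr scalemxAl.
rewrite big_split /= -scaler_suml -mulmx_suml -barycentric_expansion; last first.
  exact: flat_nondegenerate.
by rewrite -ev_sum sum_lam ev1 scale1r.
Qed.

End Frame.

Definition face_idx d r (F : {set 'I_d.+1}) (i : 'I_(d - r).+1) : 'I_d.+1 :=
  nth ord0 (enum F) i.

(** * Restriction of polynomials to faces *)

Section Faces.
Variables (R : realType) (d : nat) (a : 'I_d.+1 -> 'rV[R]_d).
Hypothesis aK : nondegenerate_simplex a.

(** Vanishing on the affine hull of the face, stated without a frame so that faces of different
    dimensions can be compared. *)
Definition on_face (F : {set 'I_d.+1}) (p : {mpoly R[d]}) : Prop :=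
  forall l : 'I_d.+1 -> R, \sum_i l i = 1 -> (forall i, i \notin F -> l i = 0) ->
    ev p (\sum_i l i *: a i) = 0.

Definition normal_to (F : {set 'I_d.+1}) (n : 'rV[R]_d) : Prop :=
  forall i j, i \in F -> j \in F -> (a i - a j) *m n^T = 0.

Lemma normal_toS (F G : {set 'I_d.+1}) n : G \subset F -> normal_to F n -> normal_to G n.
Proof. by move=> /fintype.subsetP GF h i j /GF iF /GF jF; apply: h. Qed.

Lemma on_face_sum F I (r : seq I) (P : pred I) (p : I -> {mpoly R[d]}) :
  (forall i, P i -> on_face F (p i)) -> on_face F (\sum_(i <- r | P i) p i).
Proof. by move=> h l l1 lF; rewrite ev_sum big1 // => i Pi; apply: h. Qed.

Lemma on_faceM F p q : on_face F p -> on_face F (q * p).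
Proof. by move=> h l l1 lF; rewrite ev_mul h // mulr0. Qed.

Lemma on_face_mul F m n k (A : 'M[R]_(m, n)) (B : 'M[{mpoly R[d]}]_(n, k)) :
  (forall i j, on_face F (B i j)) -> forall i j, on_face F ((cstM d A *m B) i j).
Proof. by move=> h i j; rewrite mxE; apply: on_face_sum => l _; apply: on_faceM. Qed.

Lemma on_face_mulr F m n k (A : 'M[R]_(n, k)) (B : 'M[{mpoly R[d]}]_(m, n)) :
  (forall i j, on_face F (B i j)) -> forall i j, on_face F ((B *m cstM d A) i j).
Proof.
by move=> h i j; rewrite mxE; apply: on_face_sum => l _; rewrite mulrC; apply: on_faceM.
Qed.

Section Frame.
Variables (r : nat) (F : {set 'I_d.+1}).
Hypothesis FF : F \in faces d r.
Variables (o : 'rV[R]_d) (T : 'M[R]_(d - r, d)).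
Local Notation v := (face_vtx a (r := r) F).
Hypothesis vT : cartesian_frame v o T.
Local Notation fidx := (@face_idx d r F).

Lemma size_face : size (enum F) = (d - r).+1.
Proof. by move: FF; rewrite inE => /eqP; rewrite cardE. Qed.

Lemma face_mem i : fidx i \in F.
Proof. by rewrite -mem_enum /face_idx mem_nth // size_face. Qed.

Lemma face_inj : injective fidx.
Proof.
move=> i j /eqP; rewrite /face_idx nth_uniq ?enum_uniq ?size_face //.
by move=> /eqP /val_inj.
Qed.

Lemma face_surj j : j \in F -> exists i, j = fidx i.
Proof.
rewrite -mem_enum => jF.
have h : (index j (enum F) < (d - r).+1)%N by rewrite -size_face index_mem.
by exists (Ordinal h); rewrite /face_idx nth_index.
Qed.

Lemma face_bgrad i i' j :
  ((v i - v i') *m (bgrad a (fidx j))^T) 0 0 = (i == j)%:R - (i' == j)%:R.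
Proof. by rewrite -!(inj_eq face_inj) -(vertex_bgrad aK). Qed.

Lemma face_nondegenerate : nondegenerate_simplex v.
Proof.
apply: inj_row_free => x h; apply/rowP => j; rewrite mxE.
have : (x *m edges v *m (bgrad a (fidx (lift ord0 j)))^T) 0 0 = 0.
  by rewrite h mul0mx mxE.
rewrite [x *m _]mulmx_sum_row mulmx_suml summxE (bigD1 j) //= big1.
  rewrite addr0 rowK -scalemxAl mxE face_bgrad eqxx.
  by rewrite /= subr0 mulr1.
move=> i ij; rewrite rowK -scalemxAl mxE face_bgrad.
by rewrite (inj_eq (@lift_inj _ _)) (negPf ij) /= subr0 mulr0.
Qed.

Let vK := face_nondegenerate.
Local Notation w := (flat v o T).
Let wK : nondegenerate_simplex w := flat_nondegenerate vK vT.

Let face_point (c : 'I_(d - r).+1 -> R) : \sum_i c i = 1 ->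
  exists l : 'I_d.+1 -> R, [/\ \sum_i l i = 1, \sum_i c i *: v i = \sum_j l j *: a j,
    forall j, j \notin F -> l j = 0 & forall i, l (fidx i) = c i].
Proof.
move=> c1; exists (fun j => \sum_(i | fidx i == j) c i); split.
- by rewrite -c1 [RHS](partition_big fidx xpredT).
- rewrite [LHS](partition_big fidx xpredT) //=; apply: eq_bigr => j _.
  by rewrite scaler_suml; apply: eq_bigr => i /eqP <-.
- move=> j jF; rewrite big1 // => i /eqP e; move: jF; rewrite -e.
  by rewrite (face_mem i).
- move=> i; rewrite (bigD1 i) //= big1 ?addr0 // => i' /andP[/eqP /face_inj ->].
  by rewrite eqxx.
Qed.

Lemma aff_face_eq0 p : aff o T p = 0 <-> on_face F p.
Proof.
split=> [h l l1 lF|h].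
  pose y := (\sum_j l j *: (a j - o)) *m T^T.
  have -> : \sum_i l i *: a i = o + y *m T.
    rewrite /y !mulmx_suml; transitivity (o + \sum_j l j *: (a j - o)).
      under [in RHS]eq_bigr do rewrite scalerBr.
      by rewrite sumrB -scaler_suml l1 scale1r addrC subrK.
    congr (_ + _); apply: eq_bigr => j _; rewrite -!scalemxAl.
    case: (boolP (j \in F)) => [/face_surj [i ->]|/lF ->]; last by rewrite !scale0r.
    by rewrite (frame_proj vT (vertex_sub vT i)).
  by rewrite -ev_aff h ev0.
apply: ev_eq0 => y; rewrite ev_aff (flat_barycentric vK vT).
have [|l [l1 -> lF _]] := @face_point (fun i => ev (lam w i) y).
  by rewrite -ev_sum sum_lam ev1.
exact: h.
Qed.

(** Inside the face, the zero set of the [j]-th barycentric coordinate is the affine hull of the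
    opposite subface. *)
Lemma lam_dvd_face j p : (0 < d - r)%N -> on_face (F :\ fidx j) p ->
  mdvd (lam w j) (aff o T p).
Proof.
move=> s0 h; apply/(lam_dvdP wK) => // y yj.
rewrite ev_aff (flat_barycentric vK vT).
have [|l [l1 -> lF lc]] := @face_point (fun i => ev (lam w i) y).
  by rewrite -ev_sum sum_lam ev1.
apply: h => // i; rewrite !inE negb_and negbK => /orP[/eqP ->|]; last exact: lF.
by rewrite lc.
Qed.

End Frame.

Lemma lam_dvd_facet j p : (0 < d)%N -> on_face (~: [set j]) p -> mdvd (lam a j) p.
Proof.
move=> d0 h; apply/(lam_dvdP aK) => // x xj.
rewrite (barycentric_expansion aK x); apply: h.
  by rewrite -ev_sum sum_lam ev1.
by move=> i; rewrite !inE negbK => /eqP ->.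
Qed.

End Faces.

(** * Vanishing of [tau] on faces, on facets and in the interior *)

Section Unisolvence.
Variables (R : realType) (d k : nat) (a : 'I_d.+1 -> 'rV[R]_d).
Variable nrm : forall r : nat, {set 'I_d.+1} -> 'M[R]_(r, d).
Variable org : nat -> {set 'I_d.+1} -> 'rV[R]_d.
Variable tng : forall r : nat, {set 'I_d.+1} -> 'M[R]_(d - r, d).
Hypothesis hd : (2 <= d)%N.
Hypothesis hk : (maxn d 3 <= k)%N.
Hypothesis hK : nondegenerate_simplex a.
Hypothesis hnrm : forall (r : nat) (F : {set 'I_d.+1}), (1 <= r < d)%N ->
  F \in faces d r -> normal_frame (face_vtx a (r := r) F) (nrm r F).
Hypothesis htng : forall (r : nat) (F : {set 'I_d.+1}), (1 <= r < d)%N ->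
  F \in faces d r -> cartesian_frame (face_vtx a (r := r) F) (org r F) (tng r F).

Variable tau : 'M[{mpoly R[d]}]_d.
Hypothesis tauk : PolM k tau.
Hypothesis tau_sym : tau^T = tau.
Hypothesis dof_v : forall delta : 'I_d.+1, dof_vertex a tau delta = 0.
Hypothesis dof_n : forall r F, (1 <= r < d)%N -> F \in faces d r ->
  forall (i j : 'I_r) q, Pol (k + r - d.+1) q ->
  dof_nn a tau F (org r F) (tng r F) (nrm r F) i j q = 0.
Hypothesis dof_t : forall F, F \in faces d 1 -> forall q, ND (k - 2) q ->
  dof_tn a tau F (org 1%N F) (tng 1%N F) (nrm 1%N F) q = 0.
Hypothesis dof_d : forall F, F \in faces d 1 -> forall p, Pol (k - 1) p ->
  dof_trace a tau F (org 1%N F) (tng 1%N F) (nrm 1%N F) p = 0.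
Hypothesis dof_def : forall q, ND (k - 3) q -> dof_int a tau (sym_grad q) = 0.
Hypothesis dof_ker : forall q, ker_x_PolSym (k - 2) q -> dof_int a tau q = 0.

Let dk : (d <= k)%N. Proof. by move: hk; rewrite geq_max => /andP[]. Qed.
Let k3 : (3 <= k)%N. Proof. by move: hk; rewrite geq_max => /andP[]. Qed.

Lemma normal_frame_sub r F : (1 <= r < d)%N -> F \in faces d r ->
  forall n, normal_to a F n -> (n <= nrm r F)%MS.
Proof.
move=> rd FF n hn; have [_ /andP[_ N2]] := hnrm rd FF.
apply: submx_trans N2; apply/sub_kermxP; apply: trmx_inj; rewrite trmx_mul trmxK trmx0.
apply/row_matrixP => i; rewrite row_mul row0 rowK.
by apply: hn; exact: face_mem.
Qed.

Lemma row_nrm_normal r F i : (1 <= r < d)%N -> F \in faces d r ->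
  normal_to a F (row i (nrm r F)).
Proof.
move=> rd FF; have [_ /andP[N1 _]] := hnrm rd FF.
have e l : (face_vtx a (r := r) F l - face_vtx a (r := r) F ord0) *m (row i (nrm r F))^T = 0.
  case: (unliftP ord0 l) => [l'|] ->; last by rewrite subrr mul0mx.
  have /sub_kermxP h : (row i (nrm r F) <= kermx (edges (face_vtx a (r := r) F))^T)%MS.
    exact: submx_trans (row_sub _ _) N1.
  have /(congr1 trmx) := h; rewrite trmx_mul trmxK trmx0 => /(congr1 (row l')).
  by rewrite row_mul row0 rowK.
move=> x y /(face_surj FF) [x' ->] /(face_surj FF) [y' ->].
by rewrite -(subrKA (a (@face_idx d r F ord0))) mulmxDl e -opprB mulNmx e oppr0 addr0.
Qed.

(** Induction on the number of vertices works because a normal of a face is also normal to its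
    subfaces. A single vertex is the base case, settled by the vertex values. *)
Lemma nn_on_face (F : {set 'I_d.+1}) : F != finset.set0 -> (#|F| <= d)%N -> forall n1 n2,
  normal_to a F n1 -> normal_to a F n2 ->
  on_face a F ((cstM d n1 *m tau *m cstM d n2^T) 0 0).
Proof.
have [m] := ubnP #|F|; elim: m F => // m IH F; rewrite ltnS => Fm F0 Fd n1 n2 h1 h2.
have F1 : (0 < #|F|)%N by rewrite card_gt0.
have [c1|c1] := leqP #|F| 1.
  have /cards1P [i Fi] : #|F| == 1%N by rewrite eqn_leq c1.
  move=> l l1 lF; have li j : j != i -> l j = 0.
    by move=> ji; apply: lF; rewrite Fi inE.
  have -> : \sum_j l j *: a j = a i.
    move: l1; rewrite (bigD1 i) //= big1 => [|j /li //]; rewrite addr0 => l1.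
    by rewrite (bigD1 i) //= l1 scale1r big1 ?addr0 // => j /li ->; rewrite scale0r.
  have -> : ev ((cstM d n1 *m tau *m cstM d n2^T) 0 0) (a i) =
      evM (cstM d n1 *m tau *m cstM d n2^T) (a i) 0 0 by rewrite [RHS]mxE.
  by rewrite 2!evM_mul [evM tau _]dof_v mulmx0 mul0mx mxE.
(* With this codimension [d - r] is the dimension [#|F| - 1] of the face. *)
pose r := (d - #|F|.-1)%N.
have rd : (1 <= r < d)%N by rewrite /r; lia.
have sE : (d - r = #|F|.-1)%N by rewrite /r; lia.
have FF : F \in faces d r by rewrite inE sE prednK.
have s0 : (0 < d - r)%N by rewrite sE -ltnS prednK.
have vT := htng rd FF.
have wK := flat_nondegenerate (face_nondegenerate hK FF) vT.
(* The rows of the chosen frame suffice, as every normal of the face is a combination of them. *)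
have NN i j : on_face a F ((cstM d (nrm r F) *m tau *m cstM d (nrm r F)^T) i j).
  apply/(aff_face_eq0 hK FF vT).
  have e : (cstM d (nrm r F) *m tau *m cstM d (nrm r F)^T) i j =
     (cstM d (row i (nrm r F)) *m tau *m cstM d (row j (nrm r F))^T) 0 0.
    rewrite !mxE; apply: eq_bigr => y _; rewrite !mxE; congr (_ * _).
    by apply: eq_bigr => x _; rewrite !mxE.
  apply: (prod_lam_bubble wK s0 (k := k)).
  - lia.
  - apply: Pol_aff; rewrite mxE; apply: Pol_sum => y _; rewrite mulrC mxE.
    apply: Pol_CM; rewrite mxE; apply: Pol_sum => x _; rewrite mxE.
    by apply: Pol_CM; exact: tauk.
  - move=> l; apply: (lam_dvd_face hK FF vT s0); rewrite e.
    have Fl := face_mem FF l.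
    have cl : #|F :\ face_idx F l| = #|F|.-1 by rewrite (cardsD1 (face_idx F l) F) Fl.
    apply: IH.
    + by rewrite cl; lia.
    + by rewrite -card_gt0 cl; lia.
    + by rewrite cl; lia.
    + exact: normal_toS (subD1set _ _) (row_nrm_normal _ rd FF).
    + exact: normal_toS (subD1set _ _) (row_nrm_normal _ rd FF).
  move=> q qk; rewrite -(ip_flat vT).
  by apply: dof_n => //; apply: Pol_le qk; lia.
have /submxP [D1 ->] := normal_frame_sub rd FF h1.
have /submxP [D2 ->] := normal_frame_sub rd FF h2.
rewrite trmx_mul !cstM_mul -!mulmxA; apply: on_face_mul => i j.
by rewrite !mulmxA; apply: on_face_mulr.
Qed.

Section Facet.
Variable F : {set 'I_d.+1}.
Hypothesis FF : F \in faces d 1.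
Local Notation n := (nrm 1 F).
Local Notation T := (tng 1 F).
Let rd : (1 <= 1 < d)%N. Proof. exact: hd. Qed.
Let s0 : (0 < d - 1)%N. Proof. by rewrite subn_gt0. Qed.
Let vT := htng rd FF.
Let vK := face_nondegenerate hK FF.
Let wK := flat_nondegenerate vK vT.
Let cF : #|F| = d. Proof. by move: FF; rewrite inE => /eqP ->; lia. Qed.

Lemma facet_normal : normal_to a F n.
Proof.
have := row_nrm_normal ord0 rd FF; suff -> : row ord0 n = n by [].
by apply/rowP => j; rewrite mxE ord1.
Qed.

Lemma facet_ortho : T *m n^T = 0.
Proof.
have [_ /andP[T1 _] _] := vT; have [_ /andP[N1 _]] := hnrm rd FF.
have /submxP [D ->] := T1; rewrite -mulmxA.
have /sub_kermxP /(congr1 trmx) := N1.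
by rewrite trmx_mul trmxK trmx0 => ->; rewrite mulmx0.
Qed.

(** The defect [Z] is annihilated by [T], so its columns are multiples of the normal; being
    annihilated by [n] as well, it is zero. *)
Lemma facet_resolution : T^T *m T + n^T *m n = 1%:M.
Proof.
have [NN /andP[_ N2]] := hnrm rd FF.
have TT := frame_ortho vT.
apply/eqP; rewrite -subr_eq0; set Z := _ - _.
have TZ : T *m Z = 0.
  by rewrite /Z mulmxBr mulmxDr !mulmxA TT mul1mx facet_ortho mul0mx addr0 mulmx1 subrr.
have nZ : n *m Z = 0.
  rewrite /Z mulmxBr mulmxDr !mulmxA NN mul1mx mulmx1.
  by rewrite -[n *m T^T]trmxK trmx_mul trmxK facet_ortho trmx0 mul0mx add0r subrr.
have : (Z^T <= n)%MS.
  apply: submx_trans N2; apply/sub_kermxP; apply: trmx_inj.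
  rewrite trmx_mul !trmxK trmx0 (edgesE vT) -mulmxA TZ mulmx0 //.
move=> /submxP [D ZE].
have ZE' : Z = n^T *m D^T by rewrite -trmx_mul -ZE trmxK.
have : D^T = 0 by have := nZ; rewrite ZE' mulmxA NN mul1mx.
by rewrite ZE' => ->; rewrite mulmx0.
Qed.

Lemma tn_on_facet i : on_face a F ((tau *m cstM d n^T) i 0).
Proof.
pose u := map_mx (aff (org 1 F) T) (cstM d T *m (tau *m cstM d n^T)).
have u0 : u = 0.
  apply: (bdm_unisolvent wK (n := k - 2)) => //.
  - have -> : (k - 2).+2 = k by lia.
    move=> x y; rewrite mxE; apply: Pol_aff; rewrite mxE; apply: Pol_sum => l _.
    rewrite mxE; apply: Pol_CM; rewrite mxE; apply: Pol_sum => l' _.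
    by rewrite mulrC mxE; apply: Pol_CM; exact: tauk.
  - move=> j; set g := bgrad _ _.
    (* The component of [u] along [g] is a normal-normal component of [tau] in the ambient space:
       both [g *m T] and [n] are normal to the subface opposite [j], so [nn_on_face] applies. *)
    have -> : (cstM (d - 1) g *m u) 0 0 =
        aff (org 1 F) T ((cstM d (g *m T) *m tau *m cstM d n^T) 0 0).
      rewrite cstM_mul -!mulmxA [RHS]/= !mxE rmorph_sum; apply: eq_bigr => l _.
      by rewrite rmorphM /= !mxE affC.
    apply: (lam_dvd_face hK FF vT s0).
    have Fl := face_mem FF j.
    have cl : #|F :\ face_idx F j| = d.-1.
      by have := cardsD1 (face_idx F j) F; rewrite Fl cF add1n => /(congr1 predn) /= ->.
    apply: nn_on_face.
    + by rewrite -card_gt0 cl; lia.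
    + by rewrite cl; lia.
    + move=> x y; rewrite !inE => /andP[xj /(face_surj FF) [x' xE]].
      move=> /andP[yj /(face_surj FF) [y' yE]]; move: xj yj; rewrite xE yE.
      rewrite !(inj_eq (face_inj FF)) => xj yj.
      rewrite trmx_mul mulmxA -[_ *m T^T](flatB (face_vtx a (r := 1) F) (org 1 F) T x' y').
      rewrite [LHS]mx11_scalar vertex_bgrad // (negPf xj) (negPf yj) subrr.
      exact: raddf0.
    + exact: normal_toS (subD1set _ _) facet_normal.
  - move=> q qn; apply: etrans (dof_t FF qn); rewrite /dof_tn (ipM_flat vT).
    (* The projection disappears because [T *m n^T = 0]. *)
    rewrite /PiF [in RHS]mulmxA -cstM1 -cstMN -cstMD -[in RHS]cstM_mul.
    have e : T *m (1%:M - n^T *m n) = T.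
      by rewrite mulmxBr mulmx1 mulmxA facet_ortho mul0mx subr0.
    by rewrite e.
have T0 x y : on_face a F ((cstM d T *m (tau *m cstM d n^T)) x y).
  apply/(aff_face_eq0 hK FF vT).
  by have /matrixP /(_ x y) := u0; rewrite !mxE.
have n0 x y : on_face a F ((cstM d n *m (tau *m cstM d n^T)) x y).
  rewrite !ord1 mulmxA; apply: nn_on_face; rewrite -?card_gt0 ?cF //.
  - exact: ltnW.
  - exact: facet_normal.
  - exact: facet_normal.
rewrite -[_ *m _]mul1mx -cstM1 -facet_resolution cstMD !cstM_mul mulmxDl -!mulmxA.
move=> l l1 lF; rewrite mxE ev_add (on_face_mul _ T0) // (on_face_mul _ n0) //.
exact: addr0.
Qed.

(** Since [tau n] vanishes on the facet, so do its tangential derivatives and hence [div_F]. The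
    trace moments then test [n.div tau], of degree [k - 1], against all of [P_(k-1)]. *)
Lemma ndiv_on_facet : on_face a F ((cstM d n *m row_div tau) 0 0).
Proof.
apply/(aff_face_eq0 hK FF vT).
have div0 : aff (org 1 F) T (divF T (tau *m cstM d n^T)) = 0.
  rewrite rmorph_sum big1 // => i _ /=.
  rewrite mxE rmorph_sum big1 // => l _; rewrite rmorphM /=.
  have -> : dder (row i T) (tau *m cstM d n^T) l 0 =
      \sum_j (T i j)%:MP * mderiv j ((tau *m cstM d n^T) l 0).
    by rewrite /dder summxE; apply: eq_bigr => j _; rewrite !mxE.
  have v0 : aff (org 1 F) T ((tau *m cstM d n^T) l 0) = 0.
    by apply/(aff_face_eq0 hK FF vT); exact: tn_on_facet.
  by rewrite aff_mderiv v0 mderiv0 mulr0.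
apply: (Iv_pairing_eq0 wK (m := k - 1)).
  apply: Pol_aff; rewrite mxE; apply: Pol_sum => i _; rewrite mxE; apply: Pol_CM.
  rewrite mxE; apply: Pol_sum => j _; apply: Pol_mderiv.
  by rewrite (_ : (k - 1).+1 = k); [exact: tauk | lia].
move=> q qk; have := dof_d FF qk; rewrite /dof_trace (ip_flat vT).
by rewrite rmorphD /= div0 addr0.
Qed.

End Facet.

Lemma tau_eq0 : tau = 0.
Proof.
have k3' : k = (k - 3).+3 by lia.
have facetP j : ~: [set j] \in faces d 1.
  by rewrite inE cardsC1 card_ord; apply/eqP; lia.
(* The gradient of [lam j] is normal to the facet opposite vertex [j], so the facet results give the
   divisibilities needed in the interior. *)
have gN j : exists D, bgrad a j = D *m nrm 1 (~: [set j]).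
  apply/submxP; apply: (normal_frame_sub _ (facetP j)); first exact: hd.
  move=> x y; rewrite !inE => xj yj.
  rewrite [LHS]mx11_scalar vertex_bgrad // (negPf xj) (negPf yj) subrr.
  exact: raddf0.
have d0 : (0 < d)%N by apply: leq_trans hd.
apply: (interior_unisolvent hK (n := k - 3)) => //.
- by rewrite -k3'.
- move=> j i; apply: lam_dvd_facet => //; have [D ->] := gN j.
  have -> : (cstM d (D *m nrm 1 (~: [set j])) *m tau) 0 i =
      ((tau *m cstM d (nrm 1 (~: [set j]))^T) *m cstM d D^T) i 0.
    rewrite -mulmxA -cstM_mul -trmx_mul cstM_tr -{2}tau_sym -trmx_mul.
    by rewrite [RHS]mxE.
  apply: on_face_mulr => x y; rewrite ord1; exact: tn_on_facet.
- move=> j; apply: lam_dvd_facet => //; have [D ->] := gN j.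
  rewrite cstM_mul -mulmxA; apply: on_face_mul => x y; rewrite !ord1.
  exact: ndiv_on_facet.
- move=> q qn; apply: etrans (dof_def qn).
  rewrite /dof_int /ipM -simplex_int_ev; congr simplex_int.
  by apply/funext => x; rewrite ev_tr evM_mul evM_tr.
- move=> q; rewrite (_ : (k - 3).+1 = (k - 2)%N); last by lia.
  move=> qn; apply: etrans (dof_ker qn).
  rewrite /dof_int /ipM -simplex_int_ev; congr simplex_int.
  by apply/funext => x; rewrite ev_tr evM_mul evM_tr.
Qed.

End Unisolvence.

(* nrm r F, org r F and tng r F are the chosen unit normals and the Cartesian
   coordinate system of the face F of codimension r. *)
Theorem theorem5p10 (R : realType) (d k : nat) (a : 'I_d.+1 -> 'rV[R]_d)
    (nrm : forall r : nat, {set 'I_d.+1} -> 'M[R]_(r, d))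
    (org : nat -> {set 'I_d.+1} -> 'rV[R]_d)
    (tng : forall r : nat, {set 'I_d.+1} -> 'M[R]_(d - r, d))
    (hd : (2 <= d)%N)
    (hk : (maxn d 3 <= k)%N)
    (hK : nondegenerate_simplex a)
    (h0 : in_simplex a 0)
    (hnrm : forall (r : nat) (F : {set 'I_d.+1}), (1 <= r < d)%N ->
       F \in faces d r -> normal_frame (face_vtx a (r := r) F) (nrm r F))
    (htng : forall (r : nat) (F : {set 'I_d.+1}), (1 <= r < d)%N ->
       F \in faces d r ->
       cartesian_frame (face_vtx a (r := r) F) (org r F) (tng r F)) :
  unisolvent (@PolSym R d k)
    (fun tau =>
      (forall delta : 'I_d.+1, dof_vertex a tau delta = 0) /\
      (forall r F, (1 <= r < d)%N -> F \in faces d r ->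
         forall (i j : 'I_r) q, Pol (k + r - d.+1) q ->
         dof_nn a tau F (org r F) (tng r F) (nrm r F) i j q = 0) /\
      (forall F, F \in faces d 1 -> forall q, ND (k - 2) q ->
         dof_tn a tau F (org 1%N F) (tng 1%N F) (nrm 1%N F) q = 0) /\
      (forall F, F \in faces d 1 -> forall p, Pol (k - 1) p ->
         dof_trace a tau F (org 1%N F) (tng 1%N F) (nrm 1%N F) p = 0) /\
      (forall q, ND (k - 3) q -> dof_int a tau (sym_grad q) = 0) /\
      (forall q, ker_x_PolSym (k - 2) q -> dof_int a tau q = 0))
    (ndofs R d k).
Proof.
split; last exact: has_dim_PolSym_ndofs.
move=> tau [tk ts] [dv [dn [dt [dd [ddef dker]]]]].
exact: (@tau_eq0 R d k a nrm org tng).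
Qed.
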